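(* For any $\epsilon, C > 0$ and integers $k, \ell$ with $k > 2\ell \ge 4$, there exists $\delta > 0$ such that the following holds. Let $a_1, \ldots, a_k$ be nonzero integers with $a_1 + \cdots + a_k = 0$, let $G$ be an abelian group of order $n$ with $\gcd(n, a_1\cdots a_k) = 1$, and let $S \subset G$ and $\nu : G \to [0,\infty)$ satisfy (i) $\epsilon \mathbf{1}_S \le \frac{|S|}{n}\nu$ pointwise, (ii) $\|\nu\|_{S^{2\ell}} \le C$ and $\|\nu - 1\|_\square \le \delta$. Then $S$ contains at least $\delta |S|^k/n$ solutions $(x_1,\ldots,x_k) \in S^k$ to the linear equation $a_1 x_1 + \cdots + a_k x_k = 0$.
   Context: $\mathbf{1}_S$ is the indicator function of $S$. For a finite abelian group $G$ of order $n$ and $\varphi : G\to\mathbf{C}$, put $f(x,y) := \varphi(x+y)$ on $G\times G$. Then $\|\varphi\|_{S^q}$ ($1\le q<\infty$) is the $\ell^q$ norm of the singular values of the $n\times n$ matrix with $(x,y)$ entry $f(x,y)/n$, and the cut norm is $\|\varphi\|_\square := \sup_{A,B\subset G}\left|\frac{1}{n^2}\sum_{x\in A,y\in B} \varphi(x+y)\right|$. *)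

(* Defs.v *)
From mathcomp Require Export all_boot all_order all_algebra.
From mathcomp Require Export complex.
From mathcomp Require Export all_classical all_reals all_analysis.

Set Implicit Arguments.
Unset Strict Implicit.
Unset Printing Implicit Defensive.

Import Order.TTheory GRing.Theory Num.Theory.
Local Open Scope ring_scope.
Local Open Scope complex_scope.
Local Open Scope sesquilinear_scope.

(* A^t* *m A is Hermitian and positive semidefinite, so the entries of its
   spectral_diag are its eigenvalues, listed with multiplicity, and are
   nonnegative reals; complex.Re only transports them from R[i] to R. *)
Definition singular_value (R : realType) (n : nat) (A : 'M[R[i]]_n)
    (i : 'I_n) : R :=
  Num.sqrt (complex.Re (spectral_diag (A ^t* *m A) 0 i)).

(* Rows and columns are indexed by G through enum_val : 'I_#|G| -> G; another
   enumeration only permutes them, which leaves the singular values unchanged. *)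
Definition mx_of_fun2 (R : realType) (G : finZmodType) (f : G -> G -> R[i]) :
    'M[R[i]]_#|G| :=
  \matrix_(i, j) (f (enum_val i) (enum_val j) / #|G|%:R).

(* Meant for 1 <= q. *)
Definition schatten_norm (R : realType) (G : finZmodType) (q : R)
    (phi : G -> R[i]) : R :=
  (\sum_(i < #|G|)
      singular_value (mx_of_fun2 (fun x y => phi (x + y))) i `^ q) `^ q^-1.

(* normc is the modulus with values in R; the norm `|z| on R[i] is in R[i]. *)
Definition cut_norm (R : realType) (G : finZmodType) (phi : G -> R[i]) : R :=
  sup (range (fun AB : {set G} * {set G} =>
    ComplexField.Normc.normc
      ((#|G| ^ 2)%:R^-1 * \sum_(x in AB.1) \sum_(y in AB.2) phi (x + y)))).

(* Main.v *)
(* Put eps' = min eps 1 and f = eps' (n/|S|) 1_S <= nu; the l^2l norm of the Fourier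
   coefficients of f is at most that of nu, which is the Schatten norm of nu, and
   the Fourier coefficients of nu - 1 are O(delta).  The (normalised) number of
   solutions is sum_chi prod_j f^(a_j chi), and since there are more than 2l
   factors it moves little when f is replaced by a function whose coefficients
   are uniformly close to those of f.

   Let mu be the self-correlation of the normalised indicator of a Bohr set.  The
   convolution f * mu has mean eps', and it is bounded by nu * mu <= 2 as soon as
   delta is small in terms of the density of the Bohr set: this transfers the
   problem to bounded functions.  Enlarging the Bohr spectrum step by step, by
   the characters on which f or mu has a large coefficient, the energy
   |f * mu|_2^2 <= 2 must stagnate after boundedly many steps.  At that moment
   f * mu' is L^1-close to f * mu, which is almost invariant under a Bohr set B.
   As sum_j a_j = 0, the equation is invariant under translations, so every
   solution (b_j) in B^k contributes, on average over its translates, at least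
   about (eps')^k; and B^k contains a proportion of the solutions bounded below
   independently of the a_j, by the pigeonhole principle. *)
Require Import Defs.
From mathcomp Require Import ring lra.

Set Implicit Arguments.
Unset Strict Implicit.
Unset Printing Implicit Defensive.

Import Order.TTheory GRing.Theory Num.Theory.
Import ComplexField.Normc.
Local Open Scope ring_scope.
Local Open Scope sesquilinear_scope.
Local Notation "x %:C" := (real_complex _ x) : ring_scope.

(** * Fourier analysis on a finite abelian group *)

(* The characters of G, listed by 'I_#|G|; since |chi j x| = 1, the conjugate of
   chi j x is written chi j (- x). *)
Definition dual_basis (R : realType) (G : finZmodType)
    (chi : 'I_#|G| -> G -> R[i]) : Prop :=
  [/\ forall i, {morph chi i : x y / x + y >-> x * y},
      forall i x, `|chi i x| = 1,
      forall x, \sum_i chi i x = (#|G| * (x == 0))%:R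
    & forall i j, \sum_x chi i x * chi j (- x) = (#|G| * (i == j))%:R].

(** Translation by [x] permutes [G], so adding [x] to every summand leaves the sum of all elements
    unchanged. *)
Lemma mulrn_card (G : finZmodType) (x : G) : x *+ #|G| = 0.
Proof.
apply: (addrI (\sum_(y : G) y)); rewrite addr0.
have -> : x *+ #|G| = \sum_(y : G) x by rewrite sumr_const.
rewrite -big_split /=.
by rewrite [RHS](reindex_inj (addIr x)).
Qed.

(** [psi 0] is a nonzero idempotent, and [psi x] is a root of unity because [#|G|] annihilates
    [x]. *)
Lemma norm_mult_char (C : numFieldType) (G : finZmodType) (psi : G -> C) :
  {morph psi : x y / x + y >-> x * y} -> psi 0 != 0 ->
  psi 0 = 1 /\ forall x, `|psi x| = 1.
Proof.
move=> psiM psi0; have E0 : psi 0 = 1.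
  by apply: (mulfI psi0); rewrite -psiM addr0 mulr1.
split=> // x; have psiMn m : psi (x *+ m) = psi x ^+ m.
  by elim: m => [|m IH]; rewrite ?mulr0n ?expr0 // mulrS psiM IH exprS.
have := psiMn #|G|; rewrite mulrn_card E0 => /esym/(congr1 Num.norm).
rewrite normrX normr1 => /eqP; rewrite pexpr_eq1 ?normr_ge0 //.
  by move/eqP.
by apply/card_gt0P; exists 0.
Qed.

Lemma mult_char_opp (C : numClosedFieldType) (G : finZmodType) (psi : G -> C) :
  {morph psi : x y / x + y >-> x * y} -> (forall x, `|psi x| = 1) ->
  forall x, psi (- x) = (psi x)^*.
Proof.
move=> psiM psi1 x.
have n0 y : psi y != 0 by rewrite -normr_eq0 psi1 oner_eq0.
have E0 : psi 0 = 1 by apply: (mulfI (n0 0)); rewrite -psiM addr0 mulr1.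
apply: (mulfI (n0 x)); rewrite -psiM subrr E0 -normCK psi1 expr1n //.
Qed.

(* The translations T g form a commuting family closed under adjoints, so a
   unitary matrix that triangularises all of them diagonalises them, and their
   common eigenvectors are multiples of characters. *)
Lemma dual_basis_exists (R : realType) (G : finZmodType) :
  exists chi : 'I_#|G| -> G -> R[i], dual_basis chi.
Proof.
pose e : 'I_#|G| -> G := enum_val.
pose T (g : G) : 'M[R[i]]_#|G| := \matrix_(i, j) (e j == e i + g)%:R.
have eK x : e (enum_rank x) = x by rewrite /e enum_rankK.
have eE (x : G) (j : 'I_#|G|) : (e j == x) = (j == enum_rank x).
  by rewrite /e -(inj_eq enum_rank_inj) enum_valK.
have mulT (M : 'M[R[i]]_#|G|) g i k : (M *m T g) i k = M i (enum_rank (e k - g)).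
  rewrite mxE (bigD1 (enum_rank (e k - g))) //= big1 => [|j nj].
    by rewrite addr0 mxE eK subrK eqxx mulr1.
  rewrite mxE; case: eqP => [E|_]; last by rewrite mulr0.
  by case/eqP: nj; rewrite E addrK /e enum_valK.
have commT g h : T g *m T h = T (g + h).
  apply/matrixP=> i k; rewrite mulT !mxE eK.
  by rewrite subr_eq addrAC -addrA (addrC h).
have trT g : (T g)^t* = T (- g).
  apply/matrixP=> i k; rewrite !mxE rmorph_nat; congr (_%:R).
  by rewrite -subr_eq eq_sym.
have [|P Pu /allP PT] := @cotrigonalization R[i] #|G| (codom T).
  move=> A B /codomP[g ->] /codomP[h ->].
  by rewrite /comm_mx !commT addrC.
have Punit := unitarymx_unit Pu.
have Tdiag g i j : i != j -> conjmx P (T g) i j = 0.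
  have trig h : is_trig_mx (conjmx P (T h)).
    by apply: PT; apply: codom_f.
  rewrite neq_ltn => /orP[lt_ij|lt_ji].
    by have /is_trig_mxP-> := trig g.
  (* The adjoint of [T g] is [T (- g)], triangular in the same basis; this kills the entries on the
     other side of the diagonal. *)
  have /is_trig_mxP -/(_ j i lt_ji)/eqP := trig (- g).
  rewrite -trT !conjumx// invmx_unitary// -[P as X in X *m _]trmxCK.
  by rewrite -!map_mxM -!trmx_mul mulmxA 2!mxE conjC_eq0 => /eqP.
pose d i g := conjmx P (T g) i i.
pose u i x := P i (enum_rank x).
(* Row [i] of [P], read as a function on [G], is an eigenvector of every translation, with
   eigenvalue [d i g]. *)
have ushift i g x : u i (x - g) = d i g * u i x.
  have PTE : P *m T g = conjmx P (T g) *m P by rewrite conjumx // mulmxKV.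
  have := congr1 (fun M : 'M[R[i]]_#|G| => M i (enum_rank x)) PTE.
  rewrite mulT eK /u => ->; rewrite mxE (bigD1 i) //= big1 ?addr0 //.
  by move=> j; rewrite eq_sym => /Tdiag->; rewrite mul0r.
have PPt : P *m P^t* = 1%:M by apply/unitarymxP.
have PtP : P^t* *m P = 1%:M by rewrite (mulmx1C PPt).
have sumx (F : G -> R[i]) : \sum_x F x = \sum_j F (e j).
  by rewrite (reindex e) //; exists enum_rank => x _; rewrite /e ?enum_valK ?enum_rankK.
have rowE i j : \sum_x u i x * (u j x)^* = (i == j)%:R.
  have := congr1 (fun M : 'M[R[i]]_#|G| => M i j) PPt; rewrite !mxE => <-.
  by rewrite sumx; apply: eq_bigr => k _; rewrite !mxE /u /e enum_valK.
have colE x y : \sum_i (u i x)^* * u i y = (x == y)%:R.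
  have := congr1 (fun M : 'M[R[i]]_#|G| => M (enum_rank x) (enum_rank y)) PtP; rewrite !mxE.
  rewrite (inj_eq enum_rank_inj) => <-.
  by apply: eq_bigr => k _; rewrite !mxE.
clearbody u d.
have uE i x : u i x = d i (- x) * u i 0.
  by rewrite -ushift add0r opprK.
have u0 i : u i 0 != 0.
  apply/eqP => ui0; have := rowE i i; rewrite big1 ?eqxx => [/esym/eqP|x _].
    by rewrite oner_eq0.
  by rewrite uE ui0 mulr0 mul0r.
pose chi i x := d i (- x).
have chiM i : {morph chi i : x y / x + y >-> x * y}.
  move=> x y; apply: (mulIf (u0 i)).
  have uD : u i (x + y) = d i (- y) * u i x by rewrite -ushift opprK.
  by rewrite /chi -uE uD (uE i x) mulrCA mulrA.
have chi00 i : chi i 0 != 0.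
  apply/eqP => c0; have := uE i 0; rewrite -/(chi i 0) c0 mul0r => /eqP.
  by rewrite (negPf (u0 i)).
have chi1 i x : `|chi i x| = 1 by apply: (norm_mult_char (chiM i) (chi00 i)).2.
have chiN i := mult_char_opp (chiM i) (chi1 i).
have uchi i x : u i x = chi i x * u i 0 by rewrite uE.
have ortho i j : u i 0 * (u j 0)^* * \sum_x chi i x * chi j (- x) = (i == j)%:R.
  rewrite -rowE mulr_sumr; apply: eq_bigr => x _.
  by rewrite (uchi i x) (uchi j x) chiN rmorphM /=; ring.
have chisq i : \sum_x chi i x * chi i (- x) = #|G|%:R.
  rewrite (eq_bigr (fun=> 1)) ?sumr_const // => x _.
  by rewrite chiN -normCK chi1 expr1n.
have n0 : #|G|%:R != 0 :> R[i].
  by rewrite pnatr_eq0 -lt0n; apply/card_gt0P; exists 0.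
(* All [u i 0] have the same modulus, so the orthonormality of the columns of [P] becomes the
   formula for the sum over the characters. *)
have unorm i : u i 0 * (u i 0)^* = #|G|%:R^-1.
  by apply: (mulIf n0); rewrite mulVf //; have := ortho i i; rewrite chisq eqxx.
exists chi; split=> //.
  move=> x; rewrite natrM eq_sym -colE mulr_sumr.
  apply: eq_bigr => i _; rewrite (uchi i x).
  by rewrite [_ * u i 0]mulrC [_^* * _]mulrCA [u i 0 * _]mulrA unorm mulVKf.
move=> i j; have [->|nij] := eqVneq i j; first by rewrite chisq muln1.
rewrite muln0; have := ortho i j; rewrite (negPf nij) => /eqP.
by rewrite mulf_eq0 mulf_eq0 conjC_eq0 !(negPf (u0 _)) => /eqP.
Qed.

(** * The modulus of complex numbers, with values in [R] *)

Section Modulus.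
Variable R : realType.
Implicit Types z w : R[i].

Lemma norm_normc z : (normc z)%:C = `|z|. Proof. by []. Qed.

Lemma normc_ge0 z : 0 <= normc z.
Proof. by rewrite -ler0c norm_normc. Qed.

Lemma normc_real (x : R) : normc x%:C = `|x|.
Proof. by rewrite /= expr0n /= addr0 sqrtr_sqr. Qed.

Lemma normc_sqr z : ((normc z) ^+ 2)%:C = z * z^*.
Proof. by rewrite rmorphXn /= norm_normc normCK. Qed.

Lemma conj_realC (x : R) : (x%:C)^* = x%:C.
Proof. by apply: conj_Creal; apply/complex_realP; exists x. Qed.

Lemma normc_conjC z : normc z^* = normc z.
Proof. by apply: complexI; rewrite !norm_normc norm_conjC. Qed.

Lemma le_normc_sum I (r : seq I) (P : pred I) (F : I -> R[i]) :
  normc (\sum_(i <- r | P i) F i) <= \sum_(i <- r | P i) normc (F i).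
Proof.
by rewrite -lecR rmorph_sum /= norm_normc; apply: (@ler_norm_sum _ R[i]).
Qed.

End Modulus.

(** * Averages, convolution, Fourier coefficients and weighted solution counts *)

Definition avg (R : realType) (G : finZmodType) (f : G -> R) : R :=
  #|G|%:R^-1 * \sum_x f x.

Definition conv (R : realType) (G : finZmodType) (f g : G -> R) (x : G) : R :=
  avg (fun y => f (x - y) * g y).

Definition fourier (R : realType) (G : finZmodType) (chi : 'I_#|G| -> G -> R[i])
    (f : G -> R) (i : 'I_#|G|) : R[i] :=
  #|G|%:R^-1 * \sum_x (f x)%:C * chi i (- x).

(** Once some [a j] is coprime to [#|G|], there are [#|G|^(k-1)] solutions in [G^k], and this is the
    average over them. The quotient avoids the truncated subtraction [k - 1]. *)
Definition solution_density (R : realType) (G : finZmodType) (k : nat)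
    (a : 'I_k -> int) (F : 'I_k -> G -> R) : R :=
  #|G|%:R / #|G|%:R ^+ k *
  \sum_(x : {ffun 'I_k -> G} | \sum_j x j *~ a j == 0) \prod_j F j (x j).

Section Average.
Variables (R : realType) (G : finZmodType).
Implicit Types f g : G -> R.

Lemma zmod_card_gt0 : (0 < #|G|)%N.
Proof. by apply/card_gt0P; exists 0. Qed.

Lemma cardR_gt0 : 0 < #|G|%:R :> R.
Proof. by rewrite ltr0n zmod_card_gt0. Qed.

Lemma cardC_neq0 : #|G|%:R != 0 :> R[i].
Proof. by rewrite pnatr_eq0 -lt0n zmod_card_gt0. Qed.

Lemma cardR_neq0 : #|G|%:R != 0 :> R.
Proof. by rewrite gt_eqF ?cardR_gt0. Qed.

Lemma eq_avg f g : f =1 g -> avg f = avg g.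
Proof. by move=> E; congr (_ * _); apply: eq_bigr => x _; rewrite E. Qed.

Lemma avg_cst (c : R) : avg (fun _ : G => c) = c.
Proof.
by rewrite /avg sumr_const cardT -cardE -[c *+ _]mulr_natl mulKf ?cardR_neq0.
Qed.

Lemma avgD f g : avg (fun x => f x + g x) = avg f + avg g.
Proof. by rewrite /avg big_split mulrDr. Qed.

Lemma avgB f g : avg (fun x => f x - g x) = avg f - avg g.
Proof. by rewrite /avg sumrB mulrBr. Qed.

Lemma avgZ (c : R) f : avg (fun x => c * f x) = c * avg f.
Proof. by rewrite /avg -mulr_sumr mulrCA. Qed.

Lemma le_avg f g : (forall x, f x <= g x) -> avg f <= avg g.
Proof.
by move=> le_fg; rewrite ler_wpM2l ?invr_ge0 ?ler0n // ler_sum.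
Qed.

Lemma avg_ge0 f : (forall x, 0 <= f x) -> 0 <= avg f.
Proof. by move=> /le_avg; rewrite avg_cst. Qed.

Lemma avg_shift f b : avg (fun x => f (x + b)) = avg f.
Proof. by rewrite /avg [in RHS](reindex_inj (addIr b)). Qed.

Lemma avg_opp f : avg (fun x => f (- x)) = avg f.
Proof. by rewrite /avg [in RHS](reindex_inj oppr_inj). Qed.

Lemma avg_exchange (h : G -> G -> R) :
  avg (fun x => avg (h x)) = avg (fun y => avg (h^~ y)).
Proof.
rewrite /avg -!mulr_sumr exchange_big /=.
by [].
Qed.

Lemma avg_conv f g : avg (conv f g) = avg f * avg g.
Proof.
rewrite /conv avg_exchange.
rewrite (eq_avg (g := fun y => avg f * g y)) ?avgZ // => y.
rewrite mulrC -(avg_shift f (- y)) -avgZ.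
by apply: eq_avg => x; rewrite mulrC.
Qed.

(* AM-GM: |u| <= (u^2 / s + s) / 2. *)
Lemma avg_norm_le f (s : R) : 0 < s -> avg (fun x => f x ^+ 2) <= s ^+ 2 ->
  avg (fun x => `|f x|) <= s.
Proof.
move=> s0 fs.
have H x : `|f x| <= (2 * s)^-1 * (f x ^+ 2) + s / 2.
  rewrite -(real_normK (num_real (f x))).
  have -> : (2 * s)^-1 * (`|f x| ^+ 2) + s / 2 =
            `|f x| + (2 * s)^-1 * (`|f x| - s) ^+ 2 by field; rewrite gt_eqF.
  by rewrite lerDl mulr_ge0 ?sqr_ge0 // invr_ge0 mulr_ge0 // ltW.
apply: le_trans (le_avg H) _; rewrite avgD avg_cst avgZ.
have sE : s = (2 * s)^-1 * s ^+ 2 + s / 2 by field; rewrite gt_eqF.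
rewrite [leRHS]sE; by rewrite lerD2r ler_wpM2l // invr_ge0 mulr_ge0 // ltW.
Qed.

End Average.

(** * Inversion, Parseval, the counting formula and dilations of characters *)

Section Fourier.
Variables (R : realType) (G : finZmodType) (chi : 'I_#|G| -> G -> R[i]).
Hypothesis chiP : dual_basis chi.
Implicit Types f g : G -> R.
Local Notation hat := (fourier chi).

Lemma chiD i : {morph chi i : x y / x + y >-> x * y}.
Proof. by have [] := chiP. Qed.

Lemma norm_chi i x : `|chi i x| = 1.
Proof. by have [] := chiP. Qed.

Lemma normc_chi i x : normc (chi i x) = 1.
Proof. by apply: complexI; rewrite norm_normc norm_chi. Qed.

Lemma chi0 i : chi i 0 = 1.
Proof.
apply: (@norm_mult_char _ _ _ (chiD i) _).1.
by rewrite -normr_eq0 norm_chi oner_eq0.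
Qed.

Lemma chiN i x : chi i (- x) = (chi i x)^*.
Proof. exact: mult_char_opp (@chiD i) (@norm_chi i) x. Qed.

Lemma sum_chi x : \sum_i chi i x = (#|G| * (x == 0))%:R.
Proof. by have [] := chiP. Qed.

Lemma chi_ortho i j : \sum_x chi i x * chi j (- x) = (#|G| * (i == j))%:R.
Proof. by have [] := chiP. Qed.

Lemma chi_sum i I (r : seq I) (F : I -> G) :
  chi i (\sum_(j <- r) F j) = \prod_(j <- r) chi i (F j).
Proof. by rewrite (big_morph (chi i) (chiD i) (chi0 i)). Qed.

Lemma fourierB f g i : hat (fun x => f x - g x) i = hat f i - hat g i.
Proof.
rewrite /fourier -mulrBr -sumrB; congr (_ * _); apply: eq_bigr => x _.
by rewrite rmorphB mulrBl.
Qed.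

Lemma fourier_inv f x : (f x)%:C = \sum_i hat f i * chi i x.
Proof.
under eq_bigr => i _ do rewrite /fourier -mulrA mulr_suml.
rewrite -mulr_sumr exchange_big /= (bigD1 x) //=.
under eq_bigr => i _ do rewrite -mulrA -chiD addNr.
rewrite -mulr_sumr sum_chi eqxx muln1 big1 ?addr0 => [|y nyx].
  by rewrite mulrCA mulVf ?mulr1 ?cardC_neq0.
under eq_bigr => i _ do rewrite -mulrA -chiD.
by rewrite -mulr_sumr sum_chi addrC subr_eq0 eq_sym (negPf nyx) muln0 mulr0.
Qed.

Lemma parseval f g :
  \sum_i hat f i * (hat g i)^* = (avg (fun x => f x * g x))%:C.
Proof.
rewrite /avg rmorphM fmorphV rmorph_nat rmorph_sum mulr_sumr /=.
have conjg i : (hat g i)^* = #|G|%:R^-1 * \sum_x (g x)%:C * chi i x.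
  rewrite rmorphM fmorphV rmorph_nat rmorph_sum /=; congr (_ * _).
  by apply: eq_bigr => x _; rewrite rmorphM /= chiN conjCK conj_realC.
under eq_bigr => i _ do rewrite conjg mulrCA mulr_sumr.
rewrite -mulr_sumr exchange_big /= mulr_sumr; apply: eq_bigr => x _.
congr (_ * _).
under eq_bigr => i _ do rewrite mulrCA.
by rewrite -mulr_sumr -fourier_inv rmorphM mulrC.
Qed.

Lemma parseval_sqr f : \sum_i normc (hat f i) ^+ 2 = avg (fun x => f x ^+ 2).
Proof.
apply: complexI; rewrite rmorph_sum /= -parseval.
by apply: eq_bigr => i _; rewrite normc_sqr.
Qed.

Lemma fourier_shift f b i : hat (fun x => f (x + b)) i = hat f i * chi i b.
Proof.
rewrite /fourier -mulrA mulr_suml; congr (_ * _).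
rewrite [in RHS](reindex_inj (addIr b)) /=; apply: eq_bigr => x _.
by rewrite -mulrA -chiD opprD addrNK.
Qed.

Lemma fourier_conv f g i : hat (conv f g) i = hat f i * hat g i.
Proof.
rewrite /fourier mulrACA -mulrA; congr (_ * _).
rewrite [in RHS]mulr_sumr mulr_sumr.
under [in LHS]eq_bigr => x _.
  rewrite rmorphM fmorphV rmorph_nat -mulrA rmorph_sum mulr_suml /=.
  over.
rewrite /= -mulr_sumr exchange_big /= mulr_sumr; apply: eq_bigr => y _.
congr (_ * _).
rewrite mulr_suml (reindex_inj (addIr y)) /=; apply: eq_bigr => x _.
by rewrite addrK rmorphM opprD chiD; ring.
Qed.

Lemma fourier_opp f i : hat (fun x => f (- x)) i = (hat f i)^*.
Proof.
rewrite /fourier rmorphM fmorphV rmorph_nat rmorph_sum /=; congr (_ * _).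
rewrite (reindex_inj oppr_inj) /=; apply: eq_bigr => x _.
by rewrite rmorphM /= chiN opprK conj_realC.
Qed.

Lemma normc_fourier_le f i : normc (hat f i) <= avg (fun x => `|f x|).
Proof.
rewrite /fourier /avg -[_^-1 in X in X <= _]/(_) normcM.
rewrite -(rmorph_nat (real_complex R)) -fmorphV normc_real.
rewrite ger0_norm ?invr_ge0 ?ler0n // ler_wpM2l ?invr_ge0 ?ler0n //.
apply: le_trans (le_normc_sum _ _ _) _; apply: ler_sum => x _.
by rewrite normcM normc_real normc_chi mulr1.
Qed.

(** Expanding the product leaves, for each tuple [x], the sum over [i] of
    [chi i (- \sum_j x j *~ a j)], which by orthogonality detects the solutions. *)
Lemma sum_prod_fourier k (a : 'I_k -> int) (F : 'I_k -> G -> R)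
    (s : 'I_k -> 'I_#|G| -> 'I_#|G|) :
  (forall j i x, chi (s j i) x = chi i (x *~ a j)) ->
  \sum_i \prod_j hat (F j) (s j i) = (solution_density a F)%:C.
Proof.
move=> sP; rewrite /solution_density rmorphM rmorphM fmorphV rmorphXn.
rewrite !rmorph_nat rmorph_sum /=.
under eq_bigr => i _.
  rewrite big_split /= prodr_const card_ord bigA_distr_bigA /=.
  under eq_bigr => x _ do rewrite big_split /=.
  over.
rewrite -mulr_sumr exchange_big /= mulrAC [RHS]mulrC exprVn; congr (_ * _).
rewrite mulr_sumr [RHS]big_mkcond /=; apply: eq_bigr => x _.
rewrite -mulr_sumr.
rewrite [X in _ * X](eq_bigr (fun i => chi i (- \sum_j x j *~ a j))); last first.
  move=> i _; rewrite -sumrN chi_sum; apply: eq_bigr => j _.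
  by rewrite sP mulNrz.
rewrite sum_chi oppr_eq0 rmorph_prod /= mulrC.
by case: eqP => _; rewrite ?muln1 // muln0 mul0r.
Qed.

(** The correlations of [psi] with the [chi i] add up to [#|G|], so one of them is nonzero.
    Translating the variable multiplies that correlation by [psi y * chi i (- y)], which must
    therefore be 1. *)
Lemma chi_complete (psi : G -> R[i]) :
  {morph psi : x y / x + y >-> x * y} -> psi 0 = 1 ->
  exists i, psi =1 chi i.
Proof.
move=> psiM psi0.
have [i nzi] : exists i, \sum_x psi x * chi i (- x) != 0.
  apply/existsP; apply: contraT; rewrite negb_exists => /forallP H.
  have : \sum_i \sum_x psi x * chi i (- x) = #|G|%:R.
    rewrite exchange_big /= (bigD1 0) //= -mulr_sumr sum_chi oppr0 eqxx psi0.
    rewrite mul1r muln1 big1 ?addr0 // => x nx.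
    by rewrite -mulr_sumr sum_chi oppr_eq0 (negPf nx) muln0 mulr0.
  rewrite big1 => [/esym/eqP|i _]; first by rewrite (negPf (cardC_neq0 R G)).
  by apply/eqP; have := H i; rewrite negbK.
exists i => y.
have : psi y * chi i (- y) = 1.
  apply: (mulIf nzi); rewrite mul1r mulr_sumr [RHS](reindex_inj (addrI y)) /=.
  by apply: eq_bigr => x _; rewrite psiM opprD chiD; ring.
move/(congr1 (fun z => z * chi i y)).
by rewrite -mulrA -chiD addNr chi0 mulr1 mul1r.
Qed.

(** The dilate of a character is a character, hence listed. By Bezout every element of [G] is a
    multiple of [a], so the dilate determines the character, and orthogonality then determines its
    index. *)
Lemma chi_dilation (a : int) : coprimez #|G| a ->
  exists2 s : 'I_#|G| -> 'I_#|G|,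
    injective s & forall i x, chi (s i) x = chi i (x *~ a).
Proof.
move=> cop.
have /all_sig[s sP] : forall i, {j | forall x, chi j x = chi i (x *~ a)}.
  move=> i; apply: cid.
  have [||j jP] := @chi_complete (fun x => chi i (x *~ a)).
  - by move=> x y; rewrite mulrzDl chiD.
  - by rewrite mul0rz chi0.
  by exists j => x; rewrite jP.
exists s => // i i' ss.
have [u [v]] := Bezoutz #|G| a.
rewrite (eqP cop) => uv1.
have {uv1}E (x : G) : x = (x *~ v) *~ a.
  rewrite -{1}[x]mulr1z -uv1 mulrzDr mulrC !mulrzA.
  by rewrite -pmulrn mulrn_card mul0rz add0r.
have cc : chi i =1 chi i' by move=> x; rewrite (E x) -!sP ss.
have [//|nii] := eqVneq i i'; have := chi_ortho i i'.
under eq_bigr => x _ do rewrite cc.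
rewrite chi_ortho (negPf nii) eqxx muln1 muln0 => /eqP.
by rewrite (negPf (cardC_neq0 R G)).
Qed.

End Fourier.

(** * Bohr sets and smoothing kernels *)

(** Telescoping: the factors are exchanged one at a time, and [p] bounds all the others, exchanged
    or not. *)
Lemma norm_prod_sub_le (K : numDomainType) k (u v p : 'I_k -> K) :
  (forall j, `|u j| <= p j) -> (forall j, `|v j| <= p j) ->
  `|\prod_j u j - \prod_j v j| <=
    \sum_j `|u j - v j| * \prod_(i | i != j) p i.
Proof.
elim: k => [|k IH] in u v p *; first by rewrite !big_ord0 subrr normr0.
move=> up vp; rewrite !big_ord_recl.
have p0 j : 0 <= p j by apply: le_trans (up j).
set U := \prod_(i < k) u _; set V := \prod_(i < k) v _.
have -> : u ord0 * U - v ord0 * V = (u ord0 - v ord0) * U + v ord0 * (U - V).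
  by ring.
apply: le_trans (ler_normD _ _) _; rewrite !normrM; apply: lerD.
  rewrite ler_wpM2l // big_mkcond big_ord_recl /= mul1r normr_prod.
  by apply: ler_prod => i _; rewrite normr_ge0 up.
apply: le_trans (_ : p ord0 * `|U - V| <= _); first by rewrite ler_wpM2r.
apply: le_trans (ler_wpM2l (p0 _) (IH _ _ (p \o lift ord0) _ _)) _ => //.
rewrite mulr_sumr; apply: ler_sum => j _; rewrite mulrCA ler_wpM2l //.
rewrite [leRHS]big_mkcond big_ord_recl /= -big_mkcond /= ler_wpM2l //.
Qed.

(** The product is at most the largest factor to the power [#|P|], hence to the power [m], which is
    one term of the sum. Thus an l^m bound on coefficients controls a product of at least [m] of
    them. *)
Lemma prod_le_sum_exp (K : realDomainType) (I : finType) (P : pred I)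
    (p : I -> K) m :
  (forall i, 0 <= p i <= 1) -> (0 < m <= #|P|)%N ->
  \prod_(i | P i) p i <= \sum_i p i ^+ m.
Proof.
move=> p01 /andP[m0 mP].
have [i0 Pi0] : exists i0, P i0 by apply/card_gt0P; apply: leq_trans mP.
have [j Pj jmax] := arg_maxP p Pi0.
have [pj0 pj1] := andP (p01 j).
apply: le_trans (_ : p j ^+ #|P| <= _).
  rewrite -prodr_const; apply: ler_prod => i Pi.
  by have /andP[-> _] := p01 i; exact: jmax.
apply: le_trans (_ : p j ^+ m <= _); first by rewrite ler_wiXn2l.
rewrite (bigD1 j) //= lerDl sumr_ge0 // => i _.
by rewrite exprn_ge0 //; case/andP: (p01 i).
Qed.

(** Each fibre of [h] embeds into [A] through [d] with a fixed second argument taken in the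
    fibre. *)
Lemma card_pigeonhole (T K : finType) (h : T -> K) (d : T -> T -> T)
    (A : {set T}) :
  (forall y, injective (d^~ y)) -> (forall x y, h x = h y -> d x y \in A) ->
  (#|T| <= #|A| * #|K|)%N.
Proof.
move=> d_inj hA.
have -> : #|T| = (\sum_(c : K) \sum_(x | h x == c) 1)%N.
  by rewrite -sum1_card (partition_big h predT).
rewrite mulnC -sum_nat_const; apply: leq_sum => c _.
rewrite sum1_card.
have [[y /eqP hy]|nex] := pselect (exists y, h y == c); last first.
  by rewrite eq_card0 // => x; apply/negP => hx; apply: nex; exists x.
rewrite -(card_imset _ (d_inj y)); apply: subset_leq_card.
by apply/fintype.subsetP => _ /imsetP[x /eqP hx ->]; apply: hA; rewrite hx hy.
Qed.

(** The square around the disc is cut into cells of side [1 / Q] with [2 / Q <= rho]; a distance is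
    at most the sum of its two coordinate differences. *)
Lemma unit_disc_cells (R : realType) (rho : R) : 0 < rho ->
  exists (K : finType) (cell : R[i] -> K), forall z w,
    normc z <= 1 -> normc w <= 1 -> cell z = cell w -> normc (z - w) <= rho.
Proof.
move=> rho0; pose Q := (Num.truncn (2 / rho)).+1.
have Q0 : 0 < Q%:R :> R by rewrite ltr0n.
have Qrho : 2 / Q%:R <= rho.
  rewrite ler_pdivrMr // mulrC -ler_pdivrMr //.
  by apply/ltW/truncnS_gt.
(* The successor makes room for the value [2 * Q], reached at [x = 1]; on [[-1, 1]] the conversion
   [inord] is exact. *)
pose t (x : R) : 'I_(2 * Q).+1 := inord (Num.truncn ((x + 1) * Q%:R)).
exists ('I_(2 * Q).+1 * 'I_(2 * Q).+1)%type.
exists (fun z => (t (complex.Re z), t (complex.Im z))).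
have tP (x y : R) : `|x| <= 1 -> `|y| <= 1 -> t x = t y -> `|x - y| <= Q%:R^-1.
  rewrite !ler_norml => /andP[x1 x2] /andP[y1 y2].
  have tE (s : R) : -1 <= s -> s <= 1 ->
      (t s)%:R <= (s + 1) * Q%:R < (t s)%:R + 1.
    move=> s1 s2; have s0 : 0 <= (s + 1) * Q%:R.
      by apply: mulr_ge0; [lra | exact: ltW].
    rewrite inordK; first by rewrite natr1 truncn_itv.
    rewrite ltnS -(ler_nat R) natrM.
    apply: le_trans (_ : (s + 1) * Q%:R <= _).
      by have /andP[] := truncn_itv s0.
    by apply: ler_wpM2r; [exact: ltW | lra].
  move=> txy; have /andP[xl xr] := tE x x1 x2.
  have /andP[] := tE y y1 y2; rewrite -txy => yl yr.
  have -> : x - y = ((x + 1) * Q%:R - (y + 1) * Q%:R) / Q%:R.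
    by field; rewrite gt_eqF.
  rewrite ler_pdivlMr // ler_pdivrMr // mulNr mulVf ?gt_eqF //.
  by apply/andP; split; lra.
have reim (z : R[i]) : normc z <= 1 ->
    `|complex.Re z| <= 1 /\ `|complex.Im z| <= 1.
  case: z => a b /= ab1; split; apply: le_trans ab1; rewrite -sqrtr_sqr;
  by rewrite ler_wsqrtr // ?lerDl ?lerDr sqr_ge0.
have normcle (z : R[i]) : normc z <= `|complex.Re z| + `|complex.Im z|.
  case: z => a b; rewrite /= -[leRHS]ger0_norm ?addr_ge0 // -sqrtr_sqr.
  rewrite ler_wsqrtr // sqrrD -!normrX !(ger0_norm (sqr_ge0 _)) lerD2r lerDl.
  by rewrite mulrn_wge0 // mulr_ge0.
move=> z w /reim[z1 z2] /reim[w1 w2] [E1 E2].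
apply: le_trans Qrho; apply: le_trans (normcle _) _.
have -> : 2 / Q%:R = Q%:R^-1 + Q%:R^-1 :> R by ring.
rewrite !raddfB /=.
by apply: lerD; apply: tP.
Qed.

(** * Pigeonhole lower bounds for Bohr sets and for the solutions inside them *)

Section Bohr.
Variables (R : realType) (G : finZmodType) (chi : 'I_#|G| -> G -> R[i]).
Hypothesis chiP : dual_basis chi.

Definition bohr (I : {set 'I_#|G|}) (rho : R) : {set G} :=
  [set x | [forall i in I, normc (chi i x - 1) <= rho]].

Lemma bohrP (I : {set 'I_#|G|}) (rho : R) x :
  reflect (forall i, i \in I -> normc (chi i x - 1) <= rho) (x \in bohr I rho).
Proof. by rewrite inE; apply: forall_inP. Qed.

Lemma normc_chiB i x y : normc (chi i (x - y) - 1) = normc (chi i x - chi i y).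
Proof.
have -> : chi i x - chi i y = (chi i (x - y) - 1) * chi i y.
  by rewrite mulrBl -(chiD chiP) subrK mul1r.
by rewrite normcM (normc_chi chiP) mulr1.
Qed.

Variables (rho : R) (K : finType) (cell : R[i] -> K).
Hypothesis cellP : forall z w,
  normc z <= 1 -> normc w <= 1 -> cell z = cell w -> normc (z - w) <= rho.

(** Two points at which every character of [I] falls into the same cell differ by an element of the
    Bohr set. *)
Lemma card_bohr_ge (I : {set 'I_#|G|}) :
  (#|G| <= #|bohr I rho| * #|K| ^ #|I|)%N.
Proof.
pose h x := [ffun i : {i | i \in I} => cell (chi (val i) x)].
have := @card_pigeonhole _ _ h (fun x y => x - y) (bohr I rho).
rewrite card_ffun card_sig; apply; first by move=> y; apply: addIr.
move=> x y /ffunP hxy; apply/bohrP => i iI; rewrite normc_chiB.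
apply: cellP; rewrite ?(normc_chi chiP) //.
by have := hxy (exist _ i iI); rewrite !ffunE.
Qed.

(** The class of a tuple records its cells and also the value of the linear form, whence the factor
    [#|G|]. Two tuples of one class differ by a solution inside the Bohr set, and the bound is
    uniform in [a]. *)
Lemma card_bohr_solutions_ge k (a : 'I_k -> int) (I : {set 'I_#|G|}) :
  (#|G| ^ k <= #|[set x : {ffun 'I_k -> G} |
      [forall j, x j \in bohr I rho] & (\sum_j x j *~ a j == 0)%R]|
    * ((#|K| ^ #|I|) ^ k * #|G|))%N.
Proof.
pose h (x : {ffun 'I_k -> G}) :=
  ([ffun j : 'I_k => [ffun i : {i | i \in I} => cell (chi (val i) (x j))]],
   \sum_j x j *~ a j).
set A := finset _.
have := @card_pigeonhole _ _ h (fun x y => x - y) A.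
rewrite card_prod !card_ffun card_sig card_ord; apply.
  by move=> y; apply: addIr.
move=> x y [/ffunP hxy sxy]; rewrite inE; apply/andP; split.
  apply/forallP => j; apply/bohrP => i iI; rewrite !ffunE normc_chiB.
  apply: cellP; rewrite ?(normc_chi chiP) //.
  by have /ffunP/(_ (exist _ i iI)) := hxy j; rewrite !ffunE.
apply/eqP; transitivity (\sum_j x j *~ a j - \sum_j y j *~ a j).
  by rewrite -sumrB; apply: eq_bigr => j _; rewrite !ffunE mulrzBl.
by rewrite sxy subrr.
Qed.

End Bohr.

(** The sum of the coefficients is bounded so that a uniform bound on the Fourier coefficients of
    [nu - 1] becomes a pointwise bound on its convolution with [mu]. *)
Definition smoothing_kernel (R : realType) (G : finZmodType)
    (chi : 'I_#|G| -> G -> R[i]) (mu : G -> R) (m : 'I_#|G| -> R) (M : R) :=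
  [/\ forall x, 0 <= mu x, avg mu = 1,
      forall i, fourier chi mu i = (m i)%:C,
      forall i, 0 <= m i <= 1 & \sum_i m i <= M].

(* mu is the self-correlation of the normalised indicator of a Bohr set. *)
Lemma bohr_kernel (R : realType) (rho : R) : 0 < rho <= 1 ->
  exists2 N : nat, (0 < N)%N &
    forall (G : finZmodType) (chi : 'I_#|G| -> G -> R[i]) (I : {set 'I_#|G|}),
    dual_basis chi -> exists mu m,
      smoothing_kernel chi mu m (N ^ #|I|)%:R /\
      forall i, i \in I -> 1 - rho <= m i.
Proof.
move=> /andP[rho0 rho1].
(* Half the width, because the coefficients of a self-correlation are squares and
   [(1 - rho / 2) ^+ 2 >= 1 - rho]. *)
have [|K [cell cellP]] := @unit_disc_cells R (rho / 2); first by lra.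
exists #|K|; first by apply/card_gt0P; exists (cell 0).
move=> G chi I chiP; pose B := bohr chi I (rho / 2).
have cB := card_bohr_ge chiP cellP I; rewrite -/B in cB.
have B0 : (0 < #|B|)%N.
  by rewrite lt0n; apply: contraTneq cB => ->; rewrite -ltnNge zmod_card_gt0.
have B0R : 0 < #|B|%:R :> R by rewrite ltr0n.
have G0 := cardR_gt0 R G.
pose beta x : R := #|G|%:R / #|B|%:R * (x \in B)%:R.
have beta_ge0 x : 0 <= beta x.
  by rewrite mulr_ge0 ?ler0n // divr_ge0 ?ler0n.
have sumB : \sum_(x : G) (x \in B)%:R = #|B|%:R :> R.
  by rewrite -natr_sum -big_mkcond sum1_card.
have avg_beta : avg beta = 1.
  by rewrite avgZ /avg sumB; field; rewrite !gt_eqF.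
pose beta' x := beta (- x).
pose m i := normc (fourier chi beta i) ^+ 2.
have le1 i : normc (fourier chi beta i) <= 1.
  rewrite -avg_beta; apply: le_trans (normc_fourier_le chiP _ _) _.
  by apply: le_avg => x; rewrite ger0_norm.
exists (conv beta beta'), m; split; first split.
- by move=> x; apply: avg_ge0 => y; apply: mulr_ge0; apply: beta_ge0.
- by rewrite avg_conv avg_opp avg_beta mulr1.
- by move=> i; rewrite fourier_conv // fourier_opp // -normc_sqr.
- by move=> i; rewrite sqr_ge0 expr_le1 ?normc_ge0 ?le1.
(* By Parseval the sum is the mean square of [beta], namely [#|G| / #|B|], which the pigeonhole
   bounds. *)
- rewrite parseval_sqr //.
  have -> : avg (fun x => beta x ^+ 2) = #|G|%:R / #|B|%:R.
    rewrite (eq_avg (g := fun x => #|G|%:R / #|B|%:R * beta x)).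
      by rewrite avgZ avg_beta mulr1.
    by move=> x; rewrite /beta; case: (x \in B); rewrite /=; ring.
  by rewrite ler_pdivrMr // -natrM ler_nat mulnC.
move=> i iI; have : normc (1 - fourier chi beta i) <= rho / 2.
  have -> : 1 - fourier chi beta i =
      #|G|%:R^-1 * \sum_x (beta x)%:C * (1 - chi i (- x)).
    have one : 1 = #|G|%:R^-1 * \sum_x (beta x)%:C :> R[i].
      transitivity (avg beta)%:C; first by rewrite avg_beta.
      by rewrite rmorphM fmorphV rmorph_nat rmorph_sum.
    rewrite [X in X - _]one /fourier -mulrBr -sumrB.
    by congr (_ * _); apply: eq_bigr => x _; rewrite mulrBr mulr1.
  rewrite normcM -(rmorph_nat (real_complex R)) -fmorphV.
  rewrite normc_real ger0_norm ?invr_ge0 ?ler0n //.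
  have -> : rho / 2 = avg (fun x => rho / 2 * beta x).
    by rewrite avgZ avg_beta mulr1.
  rewrite ler_wpM2l ?invr_ge0 ?ler0n //.
  apply: le_trans (le_normc_sum _ _ _) _; apply: ler_sum => x _.
  rewrite normcM normc_real ger0_norm // mulrC.
  rewrite /beta; case: (boolP (x \in B)) => [xB|_]; last by rewrite !mulr0.
  apply: ler_wpM2r; first by rewrite mulr_ge0 ?divr_ge0 ?ler0n.
  rewrite -[1](rmorph1 Num.conj) (chiN chiP) -rmorphB normc_conjC -normcN opprB.
  exact: (bohrP _ _ _ _ xB).
move=> H; have {H} : 1 - rho / 2 <= normc (fourier chi beta i).
  have := le_normcD (1 - fourier chi beta i) (fourier chi beta i).
  rewrite subrK normc1; lra.
rewrite /m; set t := normc _ => H.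
have : (1 - rho / 2) ^+ 2 <= t ^+ 2.
  by rewrite ler_pXn2r // ?nnegrE ?normc_ge0 //; lra.
by apply: le_trans; have := sqr_ge0 (rho / 2); rewrite sqrrB; lra.
Qed.

(** * Smoothed functions and the energy increment *)

(** What the counting argument retains: the cut norm hypothesis as a bound on the coefficients of
    [nu - 1], the Schatten hypothesis as an l^(2l) bound on those of [f]. *)
Definition majorized_pair (R : realType) (G : finZmodType)
    (chi : 'I_#|G| -> G -> R[i]) (eps D delta : R) (l : nat) (f nu : G -> R) :=
  [/\ forall x, 0 <= f x <= nu x, avg f = eps,
      forall i, normc (fourier chi (fun x => nu x - 1) i) <= delta
    & \sum_i normc (fourier chi f i) ^+ (2 * l) <= D].

(** Tangent line of a convex power at [e]; the inductive step gains a nonnegative multiple of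
    [(x - e) ^+ 2]. *)
Lemma bernoulli_tangent (R : realDomainType) (x e : R) k : 0 <= x -> 0 <= e ->
  e ^+ k.+1 + k.+1%:R * e ^+ k * (x - e) <= x ^+ k.+1.
Proof.
move=> x0 e0; elim: k => [|k IH]; first by rewrite expr0 !expr1; lra.
rewrite [leRHS]exprS; apply: le_trans (ler_wpM2l x0 IH).
rewrite -subr_ge0; set y := (X in 0 <= X).
have -> : y = k.+1%:R * e ^+ k * (x - e) ^+ 2.
  by rewrite /y -[k.+2%:R]natr1 !exprS; ring.
by apply: mulr_ge0 (sqr_ge0 _); rewrite mulr_ge0 ?ler0n ?exprn_ge0.
Qed.

(** Jensen's inequality: the linear term of the tangent at the mean averages to zero. *)
Lemma avg_exp_ge (R : realType) (G : finZmodType) (F : G -> R) k :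
  (forall x, 0 <= F x) -> avg F ^+ k.+1 <= avg (fun x => F x ^+ k.+1).
Proof.
move=> F0; have e0 := avg_ge0 F0; set e := avg F in e0 *.
apply: le_trans (le_avg (fun x => bernoulli_tangent k (F0 x) e0)).
by rewrite avgD avg_cst avgZ avgB avg_cst subrr mulr0 addr0.
Qed.

(** * Bounds for a majorized function convolved with a kernel *)

Section Smoothing.
Variables (R : realType) (G : finZmodType) (chi : 'I_#|G| -> G -> R[i]).
Hypothesis chiP : dual_basis chi.
Variables (eps D delta : R) (l : nat) (f nu : G -> R).
Hypotheses (eps1 : eps <= 1) (fP : majorized_pair chi eps D delta l f nu).
Local Notation hat := (fourier chi).
Local Notation energy m := (\sum_i normc (hat f i) ^+ 2 * (m i : R) ^+ 2).

Lemma fourier_le1 i : normc (hat f i) <= 1.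
Proof.
have [f0 favg _ _] := fP.
apply: le_trans (normc_fourier_le chiP _ _) _.
rewrite (eq_avg (g := f)) ?favg // => x; rewrite ger0_norm //.
by have /andP[] := f0 x.
Qed.

Section Kernel.
Variables (mu : G -> R) (m : 'I_#|G| -> R) (M : R).
Hypotheses (muP : smoothing_kernel chi mu m M) (dM : delta * M <= 1).
Local Notation F := (conv f mu).

Lemma fourier_smoothed i : hat F i = hat f i * (m i)%:C.
Proof. by have [_ _ mE _ _] := muP; rewrite fourier_conv // mE. Qed.

Lemma normc_fourier_smoothed i : normc (hat F i) = normc (hat f i) * m i.
Proof.
have [_ _ _ m01 _] := muP; have /andP[mi0 _] := m01 i.
by rewrite fourier_smoothed normcM normc_real ger0_norm.
Qed.

Lemma avg_smoothed : avg F = eps.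
Proof.
have [_ mu1 _ _ _] := muP; have [_ favg _ _] := fP.
by rewrite avg_conv mu1 mulr1.
Qed.

Lemma smoothed_ge0 x : 0 <= F x.
Proof.
have [mu0 _ _ _ _] := muP; have [f0 _ _ _] := fP.
by apply: avg_ge0 => y; apply: mulr_ge0 => //; have /andP[] := f0 (x - y).
Qed.

(** As [f <= nu], the value is at most 1 plus the convolution of [nu - 1] with [mu], and Fourier
    inversion bounds the latter by [delta * M]. *)
Lemma smoothed_le2 x : F x <= 2.
Proof.
have [mu0 mu1 mE m01 mM] := muP; have [f0 _ nud _] := fP.
pose h y := nu y - 1.
have le1 : F x <= 1 + conv h mu x.
  rewrite -{1}mu1 -avgD; apply: le_avg => y; rewrite /h mulrBl mul1r [leRHS]addrC.
  by rewrite subrK; apply: ler_wpM2r => //; have /andP[] := f0 (x - y).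
apply: le_trans le1 _; rewrite -[2]/(1 + 1) lerD2l.
apply: le_trans (ler_norm _) _; rewrite -normc_real (fourier_inv chiP).
apply: le_trans (le_normc_sum _ _ _) _; apply: le_trans dM.
have d0 : 0 <= delta.
  by apply: le_trans (normc_ge0 _) (nud (enum_rank 0)).
apply: le_trans (ler_wpM2l d0 mM); rewrite mulr_sumr; apply: ler_sum => i _.
rewrite normcM (normc_chi chiP) mulr1 fourier_conv //.
have /andP[mi0 _] := m01 i.
by rewrite mE normcM normc_real ger0_norm // ler_wpM2r ?nud.
Qed.

(** By Parseval this is the correlation of [f] with [F], and [F <= 2]. No bound on the mean square
    of [f] is at hand, so later errors are compared with this weighted sum. *)
Lemma sum_fourier_kernel_le2 : \sum_i normc (hat f i) ^+ 2 * m i <= 2.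
Proof.
have [f0 favg _ _] := fP.
have -> : \sum_i normc (hat f i) ^+ 2 * m i = avg (fun x => f x * F x).
  apply: complexI; rewrite -(parseval chiP) rmorph_sum /=.
  apply: eq_bigr => i _; rewrite fourier_smoothed [LHS]rmorphM /= normc_sqr.
  by rewrite [in RHS]rmorphM mulrA /= conj_realC.
apply: le_trans (_ : avg (fun x => 2 * f x) <= _).
  apply: le_avg => x; rewrite mulrC; have /andP[fx _] := f0 x.
  by rewrite ler_wpM2r ?smoothed_le2.
by rewrite avgZ favg -[leRHS]mulr1 ler_wpM2l.
Qed.

Lemma energyE : energy m = avg (fun x => F x ^+ 2).
Proof.
rewrite -(parseval_sqr chiP); apply: eq_bigr => i _.
by rewrite normc_fourier_smoothed exprMn.
Qed.

Lemma energy_le2 : energy m <= 2.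
Proof.
rewrite energyE; apply: le_trans (_ : avg (fun x => 2 * F x) <= _).
  by apply: le_avg => x; rewrite expr2 ler_wpM2r ?smoothed_ge0 ?smoothed_le2.
by rewrite avgZ avg_smoothed -[leRHS]mulr1 ler_wpM2l.
Qed.

(** A frequency with [rho <= m i] is moved by at most [rho]; any other has [m i ^+ 2 <= rho * m i],
    with a factor at most 4 from the shift. Both are below [5 * rho * m i], and the weighted sum is
    at most 2. *)
Lemma avg_shift_smoothed (rho : R) b : 0 < rho <= 1 ->
  b \in bohr chi [set i | rho <= m i] rho ->
  avg (fun x => (F (x + b) - F x) ^+ 2) <= 10 * rho.
Proof.
move=> /andP[rho0 rho1] /bohrP bP; have [_ _ _ m01 _] := muP.
rewrite -(parseval_sqr chiP).
apply: le_trans (_ : \sum_i 5 * rho * (normc (hat f i) ^+ 2 * m i) <= _).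
  apply: ler_sum => i _.
  rewrite fourierB fourier_shift //.
  rewrite -[X in _ - X]mulr1 -mulrBr normcM.
  rewrite normc_fourier_smoothed !exprMn [leRHS]mulrCA -[leLHS]mulrA ler_wpM2l ?sqr_ge0 //.
  have /andP[mi0 mi1] := m01 i.
  have [rm|mr] := lerP rho (m i).
    have c0 := normc_ge0 (chi i b - 1).
    have c1 : normc (chi i b - 1) <= rho by apply: bP; rewrite inE.
    set c := normc _ in c0 c1 *.
    have cc : c ^+ 2 <= rho.
      by rewrite expr2; apply: le_trans (_ : rho * rho <= _); [exact: ler_pM | nra].
    have := sqr_ge0 c; nra.
  have c2 : normc (chi i b - 1) <= 2.
    apply: le_trans (le_normcD _ _) _.
    by rewrite normcN normc1 (normc_chi chiP).
  have : normc (chi i b - 1) ^+ 2 <= 2 ^+ 2 by rewrite lerXn2r ?nnegrE ?normc_ge0.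
  have := sqr_ge0 (normc (chi i b - 1)); set c := _ ^+ 2 => h1 h2.
  have : m i ^+ 2 <= m i * rho by rewrite expr2 ler_wpM2l // ltW.
  have := sqr_ge0 (m i); set mm := _ ^+ 2 => h3 h4.
  apply: le_trans (_ : mm * 4 <= _); first by rewrite ler_wpM2l //; lra.
  by have := mulr_ge0 mi0 (ltW rho0); lra.
rewrite -mulr_sumr; have := sum_fourier_kernel_le2.
by rewrite -(ler_pM2l (_ : 0 < 5 * rho)); lra.
Qed.

End Kernel.

Lemma avg_smoothedB mu m M mu' m' M' : smoothing_kernel chi mu m M ->
  smoothing_kernel chi mu' m' M' ->
  avg (fun x => (conv f mu' x - conv f mu x) ^+ 2) =
  \sum_i normc (hat f i) ^+ 2 * (m' i - m i) ^+ 2.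
Proof.
move=> muP muP'; rewrite -(parseval_sqr chiP); apply: eq_bigr => i _.
rewrite fourierB (fourier_smoothed muP) (fourier_smoothed muP') -mulrBr -rmorphB.
by rewrite normcM normc_real exprMn real_normK ?num_real.
Qed.

(** [(m' - m)^2] exceeds [m'^2 - m^2] by [2 m (m - m')], and [m - m' <= rho] always: either
    [m < rho] or [m' >= 1 - rho]. The weighted sum, at most 2, turns [2 * rho] into [4 * rho]. *)
Lemma avg_smoothedB_le (rho : R) mu m M mu' m' M' : 0 < rho ->
  delta * M <= 1 -> smoothing_kernel chi mu m M ->
  smoothing_kernel chi mu' m' M' ->
  (forall i, rho <= m i -> 1 - rho <= m' i) ->
  avg (fun x => (conv f mu' x - conv f mu x) ^+ 2) <=
    energy m' - energy m + 4 * rho.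
Proof.
move=> rho0 dM muP muP' mm'; rewrite (avg_smoothedB muP muP').
have [_ _ _ m01 _] := muP; have [_ _ _ m01' _] := muP'.
apply: le_trans (_ : \sum_i normc (hat f i) ^+ 2 *
    (m' i ^+ 2 - m i ^+ 2 + 2 * rho * m i) <= _).
  apply: ler_sum => i _; rewrite ler_wpM2l ?sqr_ge0 //.
  have /andP[mi0 mi1] := m01 i; have /andP[mi0' mi1'] := m01' i.
  have [le_mm|lt_mm] := lerP (m i) (m' i).
    have := mulr_ge0 (ltW rho0) mi0; nra.
  have [rm|mr] := lerP rho (m i).
    by have := mm' i rm; nra.
  nra.
rewrite [leLHS](eq_bigr (fun i => normc (hat f i) ^+ 2 * m' i ^+ 2 -
    normc (hat f i) ^+ 2 * m i ^+ 2 + 2 * rho * (normc (hat f i) ^+ 2 * m i))).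
  2: by move=> i _; ring.
rewrite big_split sumrB /= lerD2l -mulr_sumr.
have := sum_fourier_kernel_le2 muP dM.
by rewrite -(ler_pM2l (_ : 0 < 2 * rho)); lra.
Qed.

(** * Passing from the solutions weighted by the smoothed function to those weighted by [f] *)

Section Counting.
Variables (k : nat) (a : 'I_k -> int) (s : 'I_k -> 'I_#|G| -> 'I_#|G|).
Hypothesis s_inj : forall j, injective (s j).
Hypothesis sP : forall j i x, chi (s j i) x = chi i (x *~ a j).
Hypotheses (l0 : (0 < l)%N) (lk : (2 * l < k)%N).

(** Exchanging one factor costs at most [eta]: a coefficient of size at least [eta] is multiplied by
    at least [1 - eta], and a smaller one moves by at most its size. The other factors are absorbed
    by the l^(2l) bound. *)
Lemma solution_density_sub_le mu m M (eta : R) : smoothing_kernel chi mu m M ->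
  0 < eta -> (forall i, eta <= normc (hat f i) -> 1 - eta <= m i) ->
  solution_density a (fun=> conv f mu) - solution_density a (fun=> f) <=
    eta * (k ^ 2)%:R * D.
Proof.
move=> muP eta0 mP; have [_ _ _ m01 _] := muP; have [_ _ _ fD] := fP.
apply: le_trans (ler_norm _) _; rewrite -normc_real.
have -> : forall x y : R, (x - y)%:C = x%:C - y%:C by move=> *; rewrite rmorphB.
rewrite -(sum_prod_fourier chiP (fun=> conv f mu) sP).
rewrite -(sum_prod_fourier chiP (fun=> f) sP) -sumrB.
apply: le_trans (le_normc_sum _ _ _) _.
(* One factor [k] comes from the choice of the exchanged coefficient, the other from the power sum
   bounding the remaining [k - 1 >= 2 * l] coefficients. *)
apply: le_trans (_ : \sum_i \sum_(j < k) eta *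
    \sum_(j' < k) normc (hat f (s j' i)) ^+ (2 * l) <= _).
  apply: ler_sum => i _.
  have := @norm_prod_sub_le _ k (fun j => hat (conv f mu) (s j i))
    (fun j => hat f (s j i)) (fun j => `|hat f (s j i)|).
  rewrite -!norm_normc => /(_ _ _)/le_trans; rewrite -lecR; apply => //.
    move=> j; rewrite -!norm_normc lecR (fourier_smoothed muP).
    have /andP[mi0 mi1] := m01 (s j i).
    by rewrite normcM normc_real ger0_norm // ler_piMr // normc_ge0.
  rewrite rmorph_sum; apply: ler_sum => j _.
  rewrite -norm_normc; under eq_bigr => i' _ do rewrite -norm_normc.
  rewrite -rmorph_prod -rmorphM lecR.
  apply: ler_pM; rewrite ?normc_ge0 //.
  - by rewrite prodr_ge0 // => i' _; apply: normc_ge0.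
  - rewrite (fourier_smoothed muP) -[X in _ - X]mulr1 -mulrBr.
    rewrite normcM -(rmorph1 (real_complex R)) -rmorphB.
    rewrite normc_real distrC; have /andP[mi0 mi1] := m01 (s j i).
    rewrite ger0_norm ?subr_ge0 //.
    have := normc_ge0 (hat f (s j i)); have := fourier_le1 (s j i).
    have [ef|fe] := lerP eta (normc (hat f (s j i))).
      have := mP _ ef; nra.
    nra.
  - apply: prod_le_sum_exp => [j'|]; first by rewrite normc_ge0 fourier_le1.
    rewrite muln_gt0 l0 /=; have := cardC1 j; rewrite card_ord.
    rewrite (eq_card (B := predC1 j)) // => ->.
    by rewrite -ltnS (ltn_predK lk).
under eq_bigr => i _ do rewrite sumr_const card_ord -mulr_natl.
rewrite -mulr_sumr -mulr_sumr exchange_big /= natrX expr2.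
rewrite [leRHS](_ : _ = k%:R * (eta * (k%:R * D))); last by ring.
rewrite !ler_wpM2l ?ler0n ?(ltW eta0) //.
apply: le_trans (_ : \sum_(j < k) D <= _); last first.
  by rewrite sumr_const card_ord mulr_natl.
(* An injective dilation permutes the characters, so the dilated power sum equals the original
   one. *)
apply: ler_sum => j _; apply: le_trans fD.
by rewrite [leRHS](reindex_inj (@s_inj j)).
Qed.

End Counting.

End Smoothing.

(** * Lower bound for the solutions by translation invariance *)

Lemma solution_density_translate (R : realType) (G : finZmodType) k
    (a : 'I_k -> int) (F : G -> R) : \sum_j a j = 0 ->
  solution_density a (fun=> F) = #|G|%:R / #|G|%:R ^+ k *
    \sum_(x : {ffun 'I_k -> G} | \sum_j x j *~ a j == 0)
      avg (fun z => \prod_j F (z + x j)).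
Proof.
move=> a0; rewrite /solution_density; congr (_ * _).
rewrite /avg -mulr_sumr exchange_big /=.
rewrite -[LHS](@avg_cst R G) /avg; congr (_ * _); apply: eq_bigr => z _.
rewrite (reindex_inj (addIr [ffun=> z])) /=.
apply: eq_big => [x|x _]; last by apply: eq_bigr => j _; rewrite !ffunE addrC.
under eq_bigr => j _ do rewrite !ffunE mulrzDl.
by rewrite big_split /= -mulrz_sumr a0 mulr0z addr0.
Qed.

(** Only the translates of the tuples of [W] are kept. On average along such a translate, replacing
    each [F' (z + x j)] by [F z] costs a telescoping error with factors at most 2, and Jensen's
    inequality handles the power of [F]. *)
Lemma solution_density_ge (R : realType) (G : finZmodType) k
    (a : 'I_k.+1 -> int) (F F' : G -> R) (s : R) (W : {set {ffun 'I_k.+1 -> G}}) :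
  \sum_j a j = 0 -> (forall x, 0 <= F x <= 2) -> (forall x, 0 <= F' x <= 2) ->
  (forall x, x \in W -> \sum_j x j *~ a j = 0 /\
     forall j, avg (fun z => `|F' (z + x j) - F z|) <= s) ->
  #|W|%:R * #|G|%:R / #|G|%:R ^+ k.+1 *
    (avg F ^+ k.+1 - k.+1%:R * 2 ^+ k.+1 * s) <=
  solution_density a (fun=> F').
Proof.
move=> a0 F02 F02' WP; rewrite solution_density_translate //.
have -> : forall A B : R, #|W|%:R * A / B = A / B * #|W|%:R by move=> *; ring.
rewrite -[leLHS]mulrA ler_wpM2l ?divr_ge0 ?exprn_ge0 ?ler0n //.
apply: le_trans (_ : \sum_(x in W) avg (fun z => \prod_j F' (z + x j)) <= _).
  rewrite [leLHS]mulr_natl -sumr_const; apply: ler_sum => x /WP[_ Fx].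
  have F2 z : F z ^+ k.+1 - 2 ^+ k.+1 * \sum_j `|F' (z + x j) - F z| <=
      \prod_j F' (z + x j).
    have := @norm_prod_sub_le _ k.+1 (fun j => F' (z + x j)) (fun=> F z) (fun=> 2).
    rewrite prodr_const card_ord lerBlDr -lerBlDl distrC => le_prod.
    apply: le_trans (ler_norm _) _; apply: le_trans (le_prod _ _) _.
    - by move=> j; have /andP[? ?] := F02' (z + x j); rewrite ger0_norm.
    - by move=> j; have /andP[? ?] := F02 z; rewrite ger0_norm.
    rewrite mulr_sumr; apply: ler_sum => j _; rewrite mulrC ler_wpM2r //.
    by rewrite prodr_const ler_weXn2l ?ler1n // -[leqRHS]card_ord max_card.
  apply: le_trans (le_avg F2).
  have F0 y : 0 <= F y by have /andP[] := F02 y.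
  rewrite avgB avgZ lerB ?avg_exp_ge //.
  rewrite [leRHS]mulrAC [leRHS]mulrC ler_wpM2l ?exprn_ge0 //.
  rewrite /avg exchange_big mulr_sumr /=.
  apply: le_trans (_ : \sum_(j < k.+1) s <= _).
    by apply: ler_sum => j _; apply: Fx.
  by rewrite sumr_const card_ord mulr_natl.
rewrite [leRHS]big_mkcond [leLHS]big_mkcond /=; apply: ler_sum => x _.
have avg0 : 0 <= avg (fun z => \prod_j F' (z + x j)).
  apply: avg_ge0 => z; apply: prodr_ge0 => j _.
  by have /andP[] := F02' (z + x j).
case: ifPn => [/WP[-> _]|_]; first by rewrite eqxx.
by case: ifP.
Qed.

(** Markov's inequality for the counting measure. *)
Lemma card_set_ge_le (R : realType) (I : finType) (p : I -> R) (t T : R) (L : nat) :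
  0 < t -> (forall i, 0 <= p i) -> \sum_i p i <= T -> T <= L%:R * t ->
  (#|[set i | (t <= p i)%R]| <= L)%N.
Proof.
move=> t0 p0 pT TL; rewrite -(ler_nat R) -(ler_pM2r t0).
apply: le_trans TL; apply: le_trans pT.
rewrite mulr_natl -sumr_const [leRHS](bigID (mem [set i | t <= p i])) /=.
rewrite -[leLHS]addr0 lerD ?sumr_ge0 // ler_sum // => i.
by rewrite inE.
Qed.

Lemma ge_natr_mul (R : realType) (T t : R) : 0 < t -> 0 <= T ->
  exists L : nat, T <= L%:R * t.
Proof.
move=> t0 T0; exists (Num.truncn (T / t)).+1.
by rewrite -ler_pdivrMr // ltW // truncnS_gt.
Qed.

Lemma le_smoothing_kernel (R : realType) (G : finZmodType)
    (chi : 'I_#|G| -> G -> R[i]) mu m M M' :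
  M <= M' -> smoothing_kernel chi mu m M -> smoothing_kernel chi mu m M'.
Proof. by move=> MM' [? ? ? ? mM]; split=> //; apply: le_trans mM MM'. Qed.

Lemma le_majorized_pair (R : realType) (G : finZmodType)
    (chi : 'I_#|G| -> G -> R[i]) eps D delta delta' l f nu :
  delta <= delta' -> majorized_pair chi eps D delta l f nu ->
  majorized_pair chi eps D delta' l f nu.
Proof.
by move=> dd' [? ? nud ?]; split=> // i; apply: le_trans (nud i) dd'.
Qed.

(* If one smoothing step does not raise the energy by s^2/2, then the new smoothed
   function is L^1-close to the old one, which is almost invariant under the Bohr
   set of Delta; the translates by solutions inside that Bohr set then already
   give the lower bound, and eta is chosen after that bound is known. *)
Lemma energy_increment (R : realType) (eps D : R) (k l : nat) :
  0 < eps <= 1 -> 0 < D -> (0 < l)%N -> (2 * l < k.+1)%N ->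
  let s := eps ^+ k.+1 / (k.+1%:R * 2 ^+ k.+1 * 4) in
  forall J M : nat, exists2 delta : R, 0 < delta &
    forall (G : finZmodType) (chi : 'I_#|G| -> G -> R[i]) (a : 'I_k.+1 -> int)
      (sg : 'I_k.+1 -> 'I_#|G| -> 'I_#|G|) (f nu mu : G -> R)
      (m : 'I_#|G| -> R),
    dual_basis chi -> \sum_j a j = 0 -> (forall j, injective (sg j)) ->
    (forall j i x, chi (sg j i) x = chi i (x *~ a j)) ->
    majorized_pair chi eps D delta l f nu ->
    smoothing_kernel chi mu m M%:R ->
    2 < \sum_i normc (fourier chi f i) ^+ 2 * m i ^+ 2 + J%:R * (s ^+ 2 / 2) ->
    delta <= solution_density a (fun=> f).
Proof.
move=> /andP[eps0 eps1] D0 l0 lk s.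
set e := eps ^+ k.+1 in s *; have e0 : 0 < e by rewrite exprn_gt0.
have e1 : e <= 1 by rewrite exprn_ile1 // ltW.
have kR : 0 < k.+1%:R * 2 ^+ k.+1 :> R by rewrite mulr_gt0 ?exprn_gt0 ?ltr0n.
have s0 : 0 < s by rewrite divr_gt0 // mulr_gt0.
(* This dictates [s]: two L^1 errors of size [s] cost, after telescoping, half of the main term
   [e]. *)
have se : k.+1%:R * 2 ^+ k.+1 * (2 * s) = e / 2.
  by rewrite /s; field; rewrite !gt_eqF ?exprn_gt0 ?ltr0n.
have s1 : s <= 1.
  rewrite ler_pdivrMr ?mulr_gt0 // mul1r.
  have : 1 <= k.+1%:R * 2 ^+ k.+1 :> R.
    by rewrite -natrX -natrM ler1n muln_gt0 expn_gt0.
  lra.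
(* Both [tau + 4 * rho] and [10 * rho] are then at most [s ^+ 2]. *)
set tau := s ^+ 2 / 2; pose rho := s ^+ 2 / 20.
have ss0 : 0 < s ^+ 2 by rewrite exprn_gt0.
have ss1 : s ^+ 2 <= 1 by rewrite exprn_ile1 // ltW.
have rho0 : 0 < rho by rewrite /rho; lra.
have rho1 : rho <= 1 by rewrite /rho; lra.
have invS (n : nat) : 0 < n.+1%:R^-1 :> R /\ n.+1%:R^-1 * n%:R <= 1 :> R.
  by split; rewrite ?invr_gt0 ?ltr0n // mulrC ler_pdivrMr ?ltr0n // mul1r ler_nat.
(* [J] bounds the number of increments [tau] that still fit below 2; at [J = 0] the hypothesis
   contradicts [energy_le2]. [M] varies because each step replaces the kernel. *)
elim=> [|J IH] M.
  exists M.+1%:R^-1; first by have [] := invS M.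
  move=> G chi a sg f nu mu m chiP _ _ _ fP muP.
  rewrite mul0r addr0 ltNge (energy_le2 chiP eps1 fP muP) //.
  by have [] := invS M.
have [K [cell cellP]] := unit_disc_cells rho0.
have K0 : (0 < #|K|)%N by apply/card_gt0P; exists (cell 0).
have [L LP] := ge_natr_mul rho0 (ler0n R M).
(* A lower bound for [#|W| * #|G| / #|G| ^ k.+1], where [W] is the set of solutions in the Bohr set
   of [Delta]. *)
pose c : R := ((#|K| ^ L) ^ k.+1)%:R^-1.
have c0 : 0 < c by rewrite invr_gt0 ltr0n !expn_gt0 K0.
(* Returning from the smoothed function to [f] will cost at most [c * e / 4], half of the main term
   [c * e / 2]. *)
pose eta := Num.min rho (c * e / (4 * (k.+1 ^ 2)%:R * D)).
have kD : 0 < 4 * (k.+1 ^ 2)%:R * D by rewrite !mulr_gt0 ?ltr0n ?expn_gt0.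
have eta0 : 0 < eta by rewrite lt_min rho0 divr_gt0 // mulr_gt0.
have eta_rho : eta <= rho by rewrite ge_min lexx.
have eta1 : eta <= 1 by apply: le_trans rho1.
have etaP : eta * (k.+1 ^ 2)%:R * D <= c * e / 4.
  have : eta <= c * e / (4 * (k.+1 ^ 2)%:R * D) by rewrite ge_min lexx orbT.
  by rewrite ler_pdivlMr //; lra.
have [N N0 NP] := @bohr_kernel R eta (introT andP (conj eta0 eta1)).
have etal0 : 0 < eta ^+ (2 * l) by rewrite exprn_gt0.
have [L' LP'] := ge_natr_mul etal0 (ltW D0).
pose M' := (N ^ (L + L'))%N.
have [delta' delta'0 IHM] := IH M'.
have [iM0 iM1] := invS M; have [iM0' iM1'] := invS M'.
(* [c * e / 4] is what remains if the energy stagnates, [delta'] serves if the induction continues,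
   and the last two give [smoothed_le2] for both kernels. *)
exists (Num.min (Num.min (c * e / 4) delta') (Num.min M.+1%:R^-1 M'.+1%:R^-1)).
  by rewrite !lt_min delta'0 iM0 iM0' divr_gt0 ?mulr_gt0.
move=> G chi a sg f nu mu m chiP a0 sg_inj sgP; set delta := Num.min _ _.
have [de dd dM dM'] : [/\ delta <= c * e / 4, delta <= delta',
    delta <= M.+1%:R^-1 & delta <= M'.+1%:R^-1].
  by rewrite /delta; split; rewrite !ge_min lexx ?orbT.
move=> fP muP EJ; have [f0 favg _ fD] := fP; have [mu0 _ _ m01 mM] := muP.
have {}dM : delta * M%:R <= 1.
  by apply: le_trans iM1; rewrite ler_wpM2r.
have {}dM' : delta * M'%:R <= 1.
  by apply: le_trans iM1'; rewrite ler_wpM2r.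
pose Delta := [set i | rho <= m i].
have cardDelta : (#|Delta| <= L)%N.
  by apply: card_set_ge_le LP => // i; have /andP[] := m01 i.
(* The large coefficients of [f], written with the power [2 * l] so that [D] bounds their number. *)
pose Spec := [set i | eta ^+ (2 * l) <= normc (fourier chi f i) ^+ (2 * l)].
have cardSpec : (#|Spec| <= L')%N.
  by apply: card_set_ge_le LP' => // i; rewrite exprn_ge0 ?normc_ge0.
have [mu' [m' [muP' mI]]] := NP G chi (Delta :|: Spec) chiP.
have {}muP' : smoothing_kernel chi mu' m' M'%:R.
  apply: le_smoothing_kernel muP'; rewrite ler_nat leq_pexp2l //.
  by apply: leq_trans (leq_card_setU _ _) _; apply: leq_add.
have m'Delta i : rho <= m i -> 1 - rho <= m' i.
  move=> rm; apply: le_trans (mI i _); first by rewrite lerB.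
  by rewrite !inE rm.
have m'Spec i : eta <= normc (fourier chi f i) -> 1 - eta <= m' i.
  move=> em; apply: mI; rewrite !inE; apply/orP; right.
  by rewrite lerXn2r // nnegrE ?normc_ge0 // ltW.
have [E'J|] := ltP 2 (\sum_i normc (fourier chi f i) ^+ 2 * m' i ^+ 2 + J%:R * tau).
  apply: (le_trans dd); have fP' := le_majorized_pair dd fP.
  exact: (IHM G chi a sg f nu mu' m' chiP a0 sg_inj sgP fP' muP' E'J).
(* Stagnation: against the hypothesis for [J.+1], the energy of [m'] exceeds that of [m] by less
   than [tau]. *)
move=> E'J; set F := conv f mu; set F' := conv f mu'.
have FF' : avg (fun x => (F' x - F x) ^+ 2) <= s ^+ 2.
  apply: le_trans (avg_smoothedB_le chiP eps1 fP rho0 dM muP muP' m'Delta) _.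
  move: EJ; rewrite -natr1 mulrDl mul1r => EJ.
  have -> : s ^+ 2 = tau + 4 * rho + 6 * rho by rewrite /tau /rho; lra.
  by lra.
pose W := [set x : {ffun 'I_k.+1 -> G} |
  [forall j, x j \in bohr chi Delta rho] & \sum_j x j *~ a j == 0].
have F02 x : 0 <= F x <= 2.
  by rewrite (smoothed_ge0 fP muP) (smoothed_le2 chiP fP muP).
have F02' x : 0 <= F' x <= 2.
  by rewrite (smoothed_ge0 fP muP') (smoothed_le2 chiP fP muP').
have := @solution_density_ge R G k a F F' (2 * s) W a0 F02 F02'.
rewrite (avg_smoothed fP muP) -/e se => densF'.
have {}densF' : c * (e / 2) <= solution_density a (fun=> F').
  apply: le_trans (densF' _) => [|x].
    have -> : e - e / 2 = e / 2 by lra.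
    rewrite ler_wpM2r ?divr_ge0 ?(ltW e0) //.
    rewrite ler_pdivlMr ?exprn_gt0 ?cardR_gt0 // mulrC.
    rewrite ler_pdivrMr ?ltr0n ?expn_gt0 ?K0 // -natrX -!natrM ler_nat.
    apply: leq_trans (card_bohr_solutions_ge chiP cellP a Delta) _.
    rewrite -mulnA leq_mul2l [leqRHS]mulnC leq_mul2r leq_exp2r //.
    by rewrite leq_pexp2l ?orbT.
  rewrite inE => /andP[/forallP xB /eqP ->]; split=> // j.
  apply: le_trans (_ : avg (fun z => `|F' (z + x j) - F (z + x j)| +
                                 `|F (z + x j) - F z|) <= _).
    apply: le_avg => z.
    rewrite (_ : F' (z + x j) - F z = (F' (z + x j) - F (z + x j)) +
      (F (z + x j) - F z)); last by ring.
    exact: ler_normD.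
  rewrite avgD mulr_natl mulr2n lerD //.
    by rewrite (avg_shift (fun z => `|F' z - F z|)) avg_norm_le.
  apply: avg_norm_le => //.
  apply: le_trans (avg_shift_smoothed chiP eps1 fP muP dM _ (xB j)) _.
    by rewrite rho0.
  by rewrite /rho; lra.
have := solution_density_sub_le chiP eps1 fP sg_inj sgP l0 lk muP' eta0 m'Spec.
rewrite -/F'; lra.
Qed.

(** * Cut norm and Schatten norm *)

Section CutNorm.
Variables (R : realType) (G : finZmodType) (h : G -> R).
Local Notation cut := (cut_norm (fun x => (h x)%:C)).
Implicit Types u v p q : G -> R.

Let pairing u v : R := \sum_x \sum_y h (x + y) * u x * v y.

Lemma cut_norm_ge (A B : {set G}) :
  `|\sum_(x in A) \sum_(y in B) h (x + y)| <= (#|G| ^ 2)%:R * cut.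
Proof.
have n0 : 0 < (#|G| ^ 2)%:R :> R by rewrite ltr0n expn_gt0 zmod_card_gt0.
rewrite mulrC -ler_pdivrMr //.
pose val (AB : {set G} * {set G}) := normc ((#|G| ^ 2)%:R^-1 *
  \sum_(x in AB.1) \sum_(y in AB.2) (h (x + y))%:C).
have -> : `|\sum_(x in A) \sum_(y in B) h (x + y)| / (#|G| ^ 2)%:R = val (A, B).
  rewrite /val /= -(rmorph_nat (real_complex R)) -fmorphV.
  have -> : \sum_(x in A) \sum_(y in B) (h (x + y))%:C =
      (\sum_(x in A) \sum_(y in B) h (x + y))%:C.
    by rewrite rmorph_sum; apply: eq_bigr => x _; rewrite rmorph_sum.
  rewrite -rmorphM normc_real normrM mulrC; congr (_ * _).
  by rewrite ger0_norm // invr_ge0 ltW.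
apply: ub_le_sup; last by exists (A, B).
(* The terms are finitely many and nonnegative, so their sum is an upper bound; [sup] is meaningful
   only for a bounded set. *)
exists (\sum_AB val AB) => _ [AB _ <-]; rewrite -/(val AB) (bigD1 AB) //=.
by rewrite lerDl sumr_ge0 // => i _; apply: normc_ge0.
Qed.

(* Maximise over u, then over v: each time the maximum is attained at a vertex
   of the cube. *)
Lemma sum_box_le (h' : G -> R) u v :
  (forall x, 0 <= u x <= 1) -> (forall x, 0 <= v x <= 1) ->
  exists A B : {set G}, \sum_x \sum_y h' (x + y) * u x * v y <=
    \sum_(x in A) \sum_(y in B) h' (x + y).
Proof.
move=> u01 v01.
have vertex (r w : G -> R) : (forall x, 0 <= w x <= 1) ->
    \sum_x r x * w x <= \sum_(x in [set x | 0 <= r x]) r x.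
  move=> w01; rewrite [leRHS]big_mkcond /=; apply: ler_sum => x _.
  have /andP[w0 w1] := w01 x; rewrite inE; case: ifP => [r0|/negbT].
    by rewrite ler_piMr.
  by rewrite -ltNge => /ltW r0; rewrite mulr_le0_ge0.
pose r x := \sum_y h' (x + y) * v y.
pose A := [set x | 0 <= r x].
pose r' y := \sum_(x in A) h' (x + y).
exists A, [set y | 0 <= r' y].
have -> : \sum_x \sum_y h' (x + y) * u x * v y = \sum_x r x * u x.
  apply: eq_bigr => x _; rewrite mulr_suml; apply: eq_bigr => y _.
  by rewrite mulrAC.
apply: le_trans (vertex r u u01) _.
rewrite /r exchange_big /= [leRHS]exchange_big /=.
rewrite (eq_bigr (fun y => r' y * v y)); last by move=> y _; rewrite mulr_suml.
exact: vertex.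
Qed.

Lemma pairing_box_le u v :
  (forall x, 0 <= u x <= 1) -> (forall x, 0 <= v x <= 1) ->
  `|pairing u v| <= (#|G| ^ 2)%:R * cut.
Proof.
move=> u01 v01; rewrite ler_norml; apply/andP; split.
  have [A [B le_AB]] := @sum_box_le (fun x => - h x) u v u01 v01.
  have {le_AB} : - pairing u v <= - \sum_(x in A) \sum_(y in B) h (x + y).
    rewrite /pairing -!sumrN; under eq_bigr => x _ do rewrite -sumrN.
    under [leRHS]eq_bigr => x _ do rewrite -sumrN.
    apply: le_trans le_AB; apply: ler_sum => x _; apply: ler_sum => y _.
    by rewrite !mulNr.
  have := ler_norm (- \sum_(x in A) \sum_(y in B) h (x + y)).
  by rewrite normrN; have := cut_norm_ge A B; lra.
have [A [B le_AB]] := sum_box_le h u01 v01.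
by apply: le_trans le_AB _; apply: le_trans (ler_norm _) (cut_norm_ge A B).
Qed.

(** Each function is [(1 + u) / 2 - (1 - u) / 2], a difference of two functions with values in
    [[0, 1]]; bilinearity gives four terms. *)
Lemma pairing_le u v :
  (forall x, `|u x| <= 1) -> (forall x, `|v x| <= 1) ->
  `|pairing u v| <= 4 * ((#|G| ^ 2)%:R * cut).
Proof.
move=> u1 v1.
have half (w : G -> R) : (forall x, `|w x| <= 1) ->
    (forall x : G, 0 <= (1 + w x) / 2 <= 1) /\
    (forall x : G, 0 <= (1 - w x) / 2 <= 1).
  by move=> w1; split=> x; have := w1 x; rewrite ler_norml => /andP[? ?];
    apply/andP; split; lra.
have [up um] := half u u1; have [vp vm] := half v v1.
have -> : pairing u v =
    pairing (fun x => (1 + u x) / 2) (fun x => (1 + v x) / 2)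
    - pairing (fun x => (1 + u x) / 2) (fun x => (1 - v x) / 2)
    - pairing (fun x => (1 - u x) / 2) (fun x => (1 + v x) / 2)
    + pairing (fun x => (1 - u x) / 2) (fun x => (1 - v x) / 2).
  rewrite /pairing -!sumrB -big_split; apply: eq_bigr => x _ /=.
  by rewrite -!sumrB -big_split; apply: eq_bigr => y _ /=; field.
have := pairing_box_le up vp; have := pairing_box_le up vm.
have := pairing_box_le um vp; have := pairing_box_le um vm.
rewrite !ler_norml => /andP[? ?] /andP[? ?] /andP[? ?] /andP[? ?].
by apply/andP; split; lra.
Qed.

(** As [chi i (- (x + y))] factors, the coefficient is a pairing of two unimodular functions. Real
    and imaginary parts give four real pairings, each at most 4 times the normalised cut norm. *)
Lemma fourier_le_cut_norm (chi : 'I_#|G| -> G -> R[i]) i :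
  dual_basis chi -> normc (fourier chi h i) <= 16 * cut.
Proof.
move=> chiP.
pose p x := complex.Re (chi i (- x)); pose q x := complex.Im (chi i (- x)).
have chiE x : chi i (- x) = (p x)%:C + 'i%C * (q x)%:C by rewrite -complexE.
have [p1 q1] : (forall x, `|p x| <= 1) /\ (forall x, `|q x| <= 1).
  suff H x : `|p x| <= 1 /\ `|q x| <= 1 by split=> x; case: (H x).
  have := normc_chi chiP i (- x); rewrite /p /q; case: (chi i (- x)) => a b /= <-.
  split; rewrite -[leLHS]sqrtr_sqr;
  by rewrite ler_wsqrtr // ?lerDl ?lerDr sqr_ge0.
have n0 : 0 < (#|G| ^ 2)%:R :> R by rewrite ltr0n expn_gt0 zmod_card_gt0.
have E : (#|G| ^ 2)%:R * fourier chi h i =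
    (pairing p p - pairing q q)%:C + 'i%C * (pairing p q + pairing q p)%:C.
  have -> : (#|G| ^ 2)%:R * fourier chi h i =
      \sum_x \sum_y (h (x + y))%:C * (chi i (- x) * chi i (- y)).
    transitivity (\sum_(x : G) \sum_y (h y)%:C * chi i (- y)).
      rewrite sumr_const cardT -cardE -[RHS]mulr_natl /fourier natrX expr2.
      by rewrite mulrA mulfK ?cardC_neq0.
    apply: eq_bigr => x _; rewrite (reindex_inj (addrI x)) /=.
    by apply: eq_bigr => y _; rewrite opprD (chiD chiP).
  rewrite /pairing rmorphB rmorphD !rmorph_sum /= mulrDr !mulr_sumr.
  rewrite -sumrB -!big_split; apply: eq_bigr => x _ /=.
  rewrite !rmorph_sum !mulr_sumr -sumrB -!big_split; apply: eq_bigr => y _ /=.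
  rewrite !chiE !rmorphM /=; have := @sqr_i R; rewrite expr2 => ii.
  set H := (h _)%:C; set a := (p x)%:C; set b := (q x)%:C.
  set c := (p y)%:C; set d := (q y)%:C; set I := 'i%C in ii *.
  transitivity (H * a * c + I * I * (H * b * d) +
    (I * (H * a * d) + I * (H * b * c))); first by ring.
  by rewrite ii mulN1r.
have : normc ((#|G| ^ 2)%:R * fourier chi h i) <= 16 * ((#|G| ^ 2)%:R * cut).
  rewrite E; apply: le_trans (le_normcD _ _) _.
  rewrite normcM !normc_real.
  have -> : normc 'i%C = 1 :> R by rewrite /= expr0n expr1n add0r sqrtr1.
  rewrite mul1r.
  have := pairing_le p1 p1; have := pairing_le q1 q1.
  have := pairing_le p1 q1; have := pairing_le q1 p1.
  have := ler_normB (pairing p p) (pairing q q).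
  have := ler_normD (pairing p q) (pairing q p); lra.
rewrite normcM -(rmorph_nat (real_complex R)) normc_real.
by rewrite (ger0_norm (ltW n0)) mulrCA ler_pM2l.
Qed.

End CutNorm.

(** * Singular values and even moments of the Fourier coefficients *)

Section Schatten.
Variables (R : realType) (G : finZmodType) (chi : 'I_#|G| -> G -> R[i]).
Hypothesis chiP : dual_basis chi.

Lemma mxtrace_conj_diag_exp (n : nat) (P : 'M[R[i]]_n) (d : 'rV[R[i]]_n) l :
  P \is unitarymx ->
  \tr ((P^t* *m diag_mx d *m P) ^+ l) = \sum_i d 0 i ^+ l.
Proof.
move=> Pu; have PP : P *m P^t* = 1%:M by apply/unitarymxP.
have -> : (P^t* *m diag_mx d *m P) ^+ l =
    P^t* *m diag_mx (\row_i d 0 i ^+ l) *m P.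
  elim: l => [|l IH].
    rewrite expr0 (_ : diag_mx _ = 1%:M) ?mulmx1 ?(mulmx1C PP) //.
    by apply/matrixP => i j; rewrite !mxE expr0.
  rewrite exprS IH -[LHS]/(_ *m _) !mulmxA -[X in X *m _ *m P]mulmxA.
  rewrite PP mulmx1 -[X in X *m P]mulmxA mulmx_diag.
  congr (_ *m diag_mx _ *m _); apply/rowP => i.
  by rewrite !mxE exprS.
by rewrite mxtrace_mulC mulmxA PP mul1mx mxtrace_diag; apply: eq_bigr => i _;
  rewrite mxE.
Qed.

(** The normalised characters diagonalise [H], with eigenvalues the squared moduli of the
    coefficients. Both sides equal the trace of [H ^+ l], which avoids matching two lists of
    eigenvalues. *)
Lemma sum_singular_value_exp (nu : G -> R) l :
  \sum_i singular_value (mx_of_fun2 (fun x y => (nu (x + y))%:C)) i ^+ (2 * l) =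
  \sum_i normc (fourier chi nu i) ^+ (2 * l).
Proof.
set A := mx_of_fun2 _; set H := A^t* *m A.
pose e : 'I_#|G| -> G := enum_val.
have n0 : 0 < #|G|%:R :> R by exact: cardR_gt0.
pose r : R := (Num.sqrt #|G|%:R)^-1.
have r2 : r%:C * r%:C = #|G|%:R^-1.
  by rewrite -rmorphM /r -invfM -expr2 sqr_sqrtr ?ltW // fmorphV rmorph_nat.
have rJ : (r%:C)^* = r%:C := conj_realC r.
pose U : 'M[R[i]]_#|G| := \matrix_(i, j) (r%:C * chi i (e j)).
pose lam : 'rV[R[i]]_#|G| := \row_i ((normc (fourier chi nu i)) ^+ 2)%:C.
have sumx (F : G -> R[i]) : \sum_x F x = \sum_j F (e j).
  by rewrite (reindex e) //; exists enum_rank => x _; rewrite /e ?enum_valK ?enum_rankK.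
have Uu : U \is unitarymx.
  apply/unitarymxP/matrixP => i j; rewrite !mxE.
  under eq_bigr => x _ do
    rewrite !mxE rmorphM /= rJ mulrACA r2 -(chiN chiP).
  rewrite -mulr_sumr -(sumx (fun x => chi i x * chi j (- x))) (chi_ortho chiP).
  by rewrite natrM mulKf ?cardC_neq0.
have HE : H = U^t* *m diag_mx lam *m U.
  apply/matrixP => i j; rewrite mul_mx_diag !mxE.
  transitivity (#|G|%:R^-1 * (avg (fun z => nu (z + e j) * nu (z + e i)))%:C).
    rewrite /avg rmorphM fmorphV rmorph_nat rmorph_sum /= mulrA mulr_sumr sumx.
    apply: eq_bigr => z _; rewrite !mxE rmorphM fmorphV rmorph_nat.
    by rewrite /= (conj_realC (nu (e z + e i))) rmorphM /=; ring.
  rewrite -(parseval chiP) mulr_sumr; apply: eq_bigr => x _.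
  rewrite !(fourier_shift chiP) !mxE normc_sqr !rmorphM /= rJ -r2; ring.
have Hh : H^t* = H by rewrite /H trmx_mul map_mxM trmxCK.
have Hn : H \is normalmx by apply/normalmxP; rewrite Hh.
set d := spectral_diag H; set P := spectralmx H.
have Pu : P \is unitarymx := spectral_unitarymx H.
have HP : H = P^t* *m diag_mx d *m P.
  by rewrite -invmx_unitary //; apply/orthomx_spectralP.
have d0 i : 0 <= d 0 i.
  have : diag_mx d = (A *m P^t*)^t* *m (A *m P^t*).
    rewrite trmx_mul map_mxM trmxCK mulmxA -[P *m _ *m A]mulmxA -/H HP !mulmxA.
    have PP : P *m P^t* = 1%:M by apply/unitarymxP.
    by rewrite PP mul1mx -!mulmxA PP mulmx1.
  move=> /matrixP/(_ i i); rewrite !mxE eqxx mulr1n => ->.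
  by apply: sumr_ge0 => j _; rewrite !mxE mulrC mul_conjC_ge0.
apply: complexI; rewrite !rmorph_sum /=.
transitivity (\tr (H ^+ l)).
  rewrite HP mxtrace_conj_diag_exp //; apply: eq_bigr => i _.
  have dR : d 0 i = (complex.Re (d 0 i))%:C by rewrite RRe_real ?ger0_real.
  rewrite /singular_value -/H -/d exprM sqr_sqrtr; last by rewrite -ler0c -dR.
  by rewrite rmorphXn /= -dR.
rewrite HE mxtrace_conj_diag_exp //; apply: eq_bigr => i _.
by rewrite mxE -rmorphXn -exprM.
Qed.

Lemma sum_fourier_le_schatten (nu : G -> R) l (C : R) : (0 < l)%N ->
  schatten_norm (2 * l)%:R (fun x => (nu x)%:C) <= C ->
  \sum_i normc (fourier chi nu i) ^+ (2 * l) <= C ^+ (2 * l).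
Proof.
move=> l0; rewrite /schatten_norm.
set S := \sum_i _ => SC.
have q0 : (2 * l)%:R != 0 :> R by rewrite pnatr_eq0 muln_eq0 -lt0n l0.
have sv0 i : 0 <= singular_value (mx_of_fun2 (fun x y => (nu (x + y))%:C)) i.
  exact: sqrtr_ge0.
have SE : S = \sum_i normc (fourier chi nu i) ^+ (2 * l).
  rewrite -sum_singular_value_exp; apply: eq_bigr => i _.
  exact: powR_mulrn.
have S0 : 0 <= S by rewrite sumr_ge0 // => i _; apply: powR_ge0.
rewrite -SE -[S]powRr1 // -(mulVf q0) powRrM powR_mulrn ?powR_ge0 //.
by rewrite lerXn2r // nnegrE ?powR_ge0 // (le_trans _ SC) // powR_ge0.
Qed.

(* The even moment counts additive configurations with nonnegative weights. *)
Lemma le_sum_fourier_exp (f nu : G -> R) l :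
  (forall x, 0 <= f x <= nu x) ->
  \sum_i normc (fourier chi f i) ^+ (2 * l) <=
  \sum_i normc (fourier chi nu i) ^+ (2 * l).
Proof.
move=> f_nu.
(* The coefficients of [auto g] are the squared moduli of those of [g], so the moment of order
   [2 * l] is a weighted count in [l] variables. *)
pose auto (g : G -> R) := conv g (fun x => g (- x)).
have dens g : \sum_i normc (fourier chi g i) ^+ (2 * l) =
    solution_density (fun _ : 'I_l => 1) (fun=> auto g).
  apply: complexI; rewrite rmorph_sum /=.
  rewrite -(sum_prod_fourier chiP (fun=> auto g) (s := fun _ i => i)) => [|//].
  apply: eq_bigr => i _; rewrite prodr_const card_ord exprM rmorphXn /= normc_sqr.
  by rewrite /auto fourier_conv // fourier_opp.
rewrite !dens ler_wpM2l ?divr_ge0 ?exprn_ge0 ?ler0n //.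
apply: ler_sum => x _; apply: ler_prod => j _; apply/andP; split.
  by apply: avg_ge0 => y; apply: mulr_ge0; [have /andP[] := f_nu (x j - y) |
    have /andP[] := f_nu (- y)].
apply: le_avg => y; have /andP[? ?] := f_nu (x j - y).
by have /andP[? ?] := f_nu (- y); apply: ler_pM.
Qed.

End Schatten.

(** * Reduction of the theorem to the energy increment *)

Local Open Scope complex_scope.

Theorem corollary1p9 (R : realType) (eps C : R) (k l : nat) :
  0 < eps -> 0 < C -> (4 <= 2 * l)%N -> (2 * l < k)%N ->
  exists delta : R, 0 < delta /\
    forall (a : 'I_k -> int) (G : finZmodType) (n : nat)
           (S : {set G}) (nu : G -> R),
      (forall i, a i != 0) ->
      \sum_(i < k) a i = 0 ->
      #|G| = n ->
      gcdz n%:Z (\prod_(i < k) a i) = 1 ->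
      (forall x, 0 <= nu x) ->
      (forall x, eps * (x \in S)%:R <= #|S|%:R / n%:R * nu x) ->
      schatten_norm (2 * l)%:R (fun x => (nu x)%:C) <= C ->
      cut_norm (fun x => (nu x - 1)%:C) <= delta ->
      delta * #|S|%:R ^+ k / n%:R <=
        #|[set x : {ffun 'I_k -> G} |
            [forall i, x i \in S] & \sum_(i < k) x i *~ a i == 0]|%:R.
Proof.
move=> eps0 C0 l2; have l0 : (0 < l)%N by case: l l2.
case: k => // k lk.
(* Lowering [eps] keeps the majorization and gives [f] a mean at most 1, as the energy bounds
   require. *)
pose eps1 := Num.min eps 1.
have eps10 : 0 < eps1 by rewrite lt_min eps0 ltr01.
have eps11 : eps1 <= 1 by rewrite ge_min lexx orbT.
have eps1e : eps1 <= eps by rewrite ge_min lexx.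
have D0 : 0 < C ^+ (2 * l) by rewrite exprn_gt0.
have e01 : 0 < eps1 <= 1 by rewrite eps10.
have := energy_increment e01 D0 l0 lk; set s := eps1 ^+ _ / _ => incr.
have s0 : 0 < s ^+ 2 / 2.
  by rewrite divr_gt0 // exprn_gt0 // divr_gt0 ?mulr_gt0 ?exprn_gt0 ?ltr0n.
(* Any number above the energy bound 2 would do for 3: [J] increments then suffice whatever the
   initial energy. *)
have [J JP] := ge_natr_mul s0 (ltW (ltr0n R 3)).
(* 16 is the constant between Fourier coefficients and the cut norm; [M = 1] fits the initial
   kernel, built on no character, since [N ^ 0 = 1]. *)
have [delta delta0 dP] := incr J 1%N; exists (delta / 16).
split=> [|a G n S nu _ a0 Gn cop nu0 Snu nuC nud]; first by rewrite divr_gt0.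
rewrite -{n}Gn in cop Snu *.
have [S0|S0] := posnP #|S|.
  by rewrite S0 expr0n mulr0 mul0r ler0n.
have SR : 0 < #|S|%:R :> R by rewrite ltr0n.
have GR := cardR_gt0 R G.
have [chi chiP] := dual_basis_exists R G.
have {}cop j : coprimez #|G| (a j).
  have : coprimez #|G| (\prod_i a i) by apply/eqP.
  by rewrite (bigD1 j) //= coprimezMr => /andP[].
have /all_sig[sg sgP] : forall j, {s : 'I_#|G| -> 'I_#|G| |
    injective s /\ forall i x, chi (s i) x = chi i (x *~ a j)}.
  by move=> j; apply: cid; have [t ? ?] := chi_dilation chiP (cop j); exists t.
pose f x : R := eps1 * #|G|%:R / #|S|%:R * (x \in S)%:R.
have f_nu x : 0 <= f x <= nu x.
  apply/andP; split; first by rewrite !mulr_ge0 ?invr_ge0 ?ler0n // ltW.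
  rewrite -(ler_pM2l (_ : 0 < #|S|%:R / #|G|%:R)) ?divr_gt0 //.
  apply: le_trans (Snu x).
  have -> : #|S|%:R / #|G|%:R * f x = eps1 * (x \in S)%:R.
    by rewrite /f; field; rewrite !gt_eqF.
  by rewrite ler_wpM2r ?ler0n.
have fP : majorized_pair chi eps1 (C ^+ (2 * l)) delta l f nu.
  split=> //.
  - rewrite avgZ /avg.
    have -> : \sum_(x : G) (x \in S)%:R = #|S|%:R :> R.
      by rewrite -natr_sum -big_mkcond sum1_card.
    by field; rewrite !gt_eqF.
  - move=> i; apply: le_trans (fourier_le_cut_norm _ _ chiP) _; lra.
  - apply: le_trans (le_sum_fourier_exp chiP l f_nu) _.
    exact: sum_fourier_le_schatten.
have one1 : 0 < (1 : R) <= 1 by rewrite ltr01 lexx.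
have [N _ /(_ G chi finset.set0 chiP)[mu [m [muP _]]]] := bohr_kernel one1.
rewrite cards0 expn0 in muP.
have : 2 < \sum_i normc (fourier chi f i) ^+ 2 * m i ^+ 2 + J%:R * (s ^+ 2 / 2).
  apply: lt_le_trans (_ : J%:R * (s ^+ 2 / 2) <= _).
    by apply: lt_le_trans JP; rewrite ltr_nat.
  by rewrite lerDr sumr_ge0 // => i _; rewrite mulr_ge0 ?sqr_ge0.
move/(dP G chi a sg f nu mu m chiP a0 (fun j => (sgP j).1) (fun j => (sgP j).2)
  fP muP).
set T := finset _.
have -> : solution_density a (fun=> f) =
    #|G|%:R * eps1 ^+ k.+1 / #|S|%:R ^+ k.+1 * #|T|%:R.
  rewrite /solution_density.
  have -> : \sum_(x : {ffun 'I_k.+1 -> G} | \sum_j x j *~ a j == 0)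
      \prod_j f (x j) = (eps1 * #|G|%:R / #|S|%:R) ^+ k.+1 * #|T|%:R.
    rewrite -[#|T|]sum1_card natr_sum mulr_sumr big_mkcond [RHS]big_mkcond /=.
    apply: eq_bigr => x _; rewrite inE andbC; case: ifP => //= _.
    case: ifPn => [/forallP xS|/forallPn[j xj]].
      rewrite mulr1 -[k.+1 in RHS]card_ord -prodr_const.
      by apply: eq_bigr => j _; rewrite /f xS mulr1.
    by rewrite (bigD1 j) //= /f (negPf xj) mulr0 mul0r.
  rewrite !exprMn exprVn; field.
  by rewrite !gt_eqF ?exprn_gt0.
have ek : eps1 ^+ k.+1 <= 1 by rewrite exprn_ile1 // ltW.
have ek0 : 0 < eps1 ^+ k.+1 by rewrite exprn_gt0.
set Sk := #|S|%:R ^+ k.+1; have Sk0 : 0 < Sk by rewrite exprn_gt0.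
move=> H; rewrite ler_pdivrMr //.
have {H} : delta * Sk <= #|G|%:R * eps1 ^+ k.+1 * #|T|%:R.
  by move: H; rewrite mulrAC ler_pdivlMr.
have : #|G|%:R * eps1 ^+ k.+1 * #|T|%:R <= #|T|%:R * #|G|%:R :> R.
  by rewrite mulrAC mulrC [leRHS]mulrC -[leRHS]mul1r ler_wpM2r // mulr_ge0 ?ler0n.
have : delta / 16 * Sk <= delta * Sk by rewrite ler_pM2r //; lra.
lra.
Qed.
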